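(* Let $m\ge2$ and let $T\subseteq[m-1]$ be a set of coranks of $\Omega_m$. Then $b'_m(T)=0$ if and only if $\{m-2,m-1\}\subseteq T$. More precisely: (a) If $\{m-2,m-1\}\subseteq T$, then $b'_m(T)=0$. (b) If $m-1\in T$ and $m-2\notin T$, then $b'_m(T)\ge1$; in fact $b'_m(T)=\gamma_m(T)=(m-1)\,b_{m-1}(T\setminus\{m-1\})$. (c) If $m-1\notin T$, then $b'_m(T)\ge1$; in fact $b'_m(T)=m\,b_m(T)-(m-1)\,b_{m-1}(T)$.
   Context: An ordered set partition of $[n]$ is a sequence of nonempty disjoint blocks with union $[n]$. These are ordered by merging adjacent blocks in place (covers $(B_1,\ldots,B_k)\lessdot(B_1,\ldots,B_i\cup B_{i+1},\ldots,B_k)$, extended transitively); $\Omega_n$ is this poset with a minimum $\hat0$ adjoined; it is graded of rank $n$ with maximum $([n])$, and $\operatorname{crk}x=n-\operatorname{rk}x$. $\mathfrak S_n$ acts by permuting block entries. For $T\subseteq[n-1]$, $\Omega_n(T)=\{x:\operatorname{crk}x\in T\}\cup\{\hat0,\hat1\}$, with top reduced rational homology of the order complex of its proper part (trivial module when $T=\emptyset$). $b_n(T)$ is the multiplicity of the trivial representation of $\mathfrak S_n$ in this homology of $\Omega_n(T)$; $b'_m(T)$ is the multiplicity of the trivial representation of $\mathfrak S_{m-1}$ (the subgroup of $\mathfrak S_m$ fixing $m$) in the homology of $\Omega_m(T)$; and $\gamma_m(T)=b'_m(T)-b_m(T)$. *)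

(* Defs.v *)
From HB Require Import structures.
From mathcomp Require Import all_boot all_order all_fingroup all_algebra.
From mathcomp Require Import mxrepresentation finmap.

Set Implicit Arguments.
Unset Strict Implicit.
Unset Printing Implicit Defensive.

Import Order.TTheory GRing.Theory Num.Theory.
Import GroupScope.
Local Open Scope nat_scope.

Section OrderComplex.

Variables (disp : Order.disp_t) (P : finPOrderType disp).

Definition is_chain (c : {set P}) : bool :=
  [forall x in c, forall y in c, (x >=< y)%O].

(* The greatest length of a chain with top element x: this is the rank of x when
   P is graded. *)
Definition rk (x : P) : nat :=
  \max_(c : {set P} | is_chain c && [forall y in c, (y < x)%O]) #|c|.

Definition proper_part (A : {set P}) : {set P} :=
  [set x in A | ~~ [forall y in A, (x <= y)%O] & ~~ [forall y in A, (y <= x)%O]].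

(* The order complex of the subposet A. All indices k below are numbers of
   vertices, so k corresponds to dimension, or reduced degree, k - 1; the empty
   face (k = 0) is kept, which makes the homology reduced. *)
Definition faces (A : {set P}) (k : nat) : {set {set P}} :=
  [set c : {set P} | [&& is_chain c, c \subset A & #|c| == k]].

(* Simplicial chains are row vectors indexed by all subsets of P; those of
   degree k - 1 form the row space of [faces_mx A k]. *)
Definition set_vec (c : {set P}) : 'rV[rat]_#|{set P}| :=
  delta_mx 0%R (enum_rank c).

Definition faces_mx (A : {set P}) (k : nat) : 'M[rat]_#|{set P}| :=
  diag_mx (\row_i (enum_val i \in faces A k)%:R%R).

(* On x_0 < ... < x_d this is the usual sum of (-1)^i [.. omit x_i ..]. *)
Definition boundary (c : {set P}) : 'rV[rat]_#|{set P}| :=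
  (\sum_(x in c) (-1) ^+ #|[set y in c | (y < x)%O]| *: set_vec (c :\ x))%R.

Definition boundary_mx : 'M[rat]_#|{set P}| :=
  \matrix_i boundary (enum_val i).

Definition cycles (A : {set P}) (k : nat) : 'M[rat]_#|{set P}| :=
  (faces_mx A k :&: kermx boundary_mx)%MS.

Definition boundaries (A : {set P}) (k : nat) : 'M[rat]_#|{set P}| :=
  <<faces_mx A k.+1 *m boundary_mx>>%MS.

Section Action.

Variables (gT : finGroupType) (to : {action gT &-> P}) (A : {set P}).
Hypothesis to_le : forall g x y, (to x g <= to y g)%O = (x <= y)%O.
Hypothesis to_A : forall g x, (to x g \in A) = (x \in A).

Definition set_act_mx (g : gT) : 'M[rat]_#|{set P}| :=
  \matrix_i set_vec [set to x g | x in (enum_val i : {set P})].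

Lemma set_vec_act (c : {set P}) g :
  (set_vec c *m set_act_mx g)%R = set_vec [set to x g | x in c].
Proof. by rewrite -rowE rowK enum_rankK. Qed.

Lemma set_vec_boundary c : (set_vec c *m boundary_mx)%R = boundary c.
Proof. by rewrite -rowE rowK enum_rankK. Qed.

Lemma set_act_repr : mx_repr [set: gT] set_act_mx.
Proof.
split=> [|g h _ _]; apply/row_matrixP=> i.
  rewrite rowK row1 -[i in RHS]enum_valK; congr set_vec.
  by rewrite (eq_imset _ (act1 to)) imset_id.
rewrite row_mul rowK [in RHS]rowK set_vec_act -imset_comp; congr set_vec.
by apply: eq_imset => x; rewrite /= actM.
Qed.

Canonical set_repr := MxRepresentation set_act_repr.

Lemma to_lt g x y : (to x g < to y g)%O = (x < y)%O.
Proof. by rewrite !lt_neqAle to_le (inj_eq (act_inj to g)). Qed.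

Lemma is_chain_act (c : {set P}) g : is_chain [set to x g | x in c] = is_chain c.
Proof.
apply/forall_inP/forall_inP => H x xc.
  apply/forall_inP => y yc.
  have /forall_inP/(_ _ (imset_f (to^~ g) yc)) := H _ (imset_f (to^~ g) xc).
  by rewrite /Order.comparable !to_le.
case/imsetP: xc => {}x xc ->; apply/forall_inP => _ /imsetP[y yc ->].
by have /forall_inP/(_ _ yc) := H _ xc; rewrite /Order.comparable !to_le.
Qed.

Lemma rk_act x g : rk (to x g) = rk x.
Proof.
have le_rk h z : rk z <= rk (to z h).
  apply/bigmax_leqP=> c /andP[ch_c /forall_inP c_lt].
  rewrite -(card_imset _ (act_inj to h)); apply: leq_bigmax_cond.
  rewrite is_chain_act ch_c; apply/forall_inP=> _ /imsetP[y yc ->].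
  by rewrite to_lt c_lt.
by apply/eqP; rewrite eqn_leq le_rk -{2}(actK to g x) le_rk.
Qed.

Lemma greatest_act x g :
  [forall y, (y <= to x g)%O] = [forall y, (y <= x)%O].
Proof.
apply/forallP/forallP => H y; first by rewrite -(to_le g).
by rewrite -(actKV to g y) to_le.
Qed.

Lemma proper_part_act x g : (to x g \in proper_part A) = (x \in proper_part A).
Proof.
rewrite !inE to_A; congr [&& _, ~~ _ & ~~ _].
  apply/forall_inP/forall_inP => H y yA; first by rewrite -(to_le g) H ?to_A.
  by rewrite -(actKV to g y) to_le H // -(to_A g) actKV.
apply/forall_inP/forall_inP => H y yA; first by rewrite -(to_le g) H ?to_A.
by rewrite -(actKV to g y) to_le H // -(to_A g) actKV.
Qed.

Lemma faces_act k (c : {set P}) g : ([set to x g | x in c] \in faces A k) = (c \in faces A k).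
Proof.
have inj := act_inj to g.
rewrite !inE card_imset // is_chain_act; congr [&& _, _ & _].
apply/subsetP/subsetP => H x xc.
  by rewrite -(to_A g) H //; apply: imset_f.
by case/imsetP: xc => {}x xc ->; rewrite to_A H.
Qed.

Lemma boundary_act (c : {set P}) g :
  (boundary c *m set_act_mx g)%R = boundary [set to x g | x in c].
Proof.
have inj := act_inj to g; rewrite /boundary mulmx_suml big_imset /=; last first.
  by move=> x y _ _ /inj.
apply: eq_bigr => x xc; rewrite -scalemxAl set_vec_act.
congr (_ ^+ _ *: set_vec _)%R; last first.
  apply/setP=> z; apply/imsetP/setD1P=> [[y /setD1P[yx yc] ->] | [zx]].
    by rewrite (inj_eq inj); split=> //; apply: imset_f.
  case/imsetP=> y yc z_y; exists y => //; apply/setD1P; split=> //.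
  by apply: contraNneq zx => y_x; rewrite z_y y_x.
rewrite -(card_imset _ inj); apply: eq_card => y; rewrite inE.
apply/imsetP/andP=> [[z] | [/imsetP[z zc ->]]].
  by rewrite inE => /andP[zc zx] ->; rewrite to_lt; split=> //; apply: imset_f.
by rewrite to_lt => zx; exists z; rewrite // inE zc.
Qed.

Lemma boundary_mx_act g : (boundary_mx *m set_act_mx g = set_act_mx g *m boundary_mx)%R.
Proof.
apply/row_matrixP=> i; rewrite !row_mul !rowK boundary_act.
by rewrite set_vec_boundary.
Qed.

Lemma row_faces_mx k i :
  row i (faces_mx A k) = ((enum_val i \in faces A k)%:R *: set_vec (enum_val i))%R.
Proof. by rewrite row_diag_mx mxE /set_vec enum_valK. Qed.

Lemma faces_mx_module k : mxmodule set_repr (faces_mx A k).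
Proof.
apply/mxmoduleP=> g _; apply/row_subP=> i; rewrite row_mul row_faces_mx.
rewrite -scalemxAl set_vec_act -(faces_act k _ g).
set c := [set _ | _ in _].
by have := row_sub (enum_rank c) (faces_mx A k); rewrite row_faces_mx enum_rankK.
Qed.

Lemma cycles_module k : mxmodule set_repr (cycles A k).
Proof.
apply: capmx_module; first exact: faces_mx_module.
apply/mxmoduleP=> g _; apply/sub_kermxP.
by rewrite -mulmxA -boundary_mx_act mulmxA mulmx_ker mul0mx.
Qed.

Lemma boundaries_module k : mxmodule set_repr (boundaries A k).
Proof.
apply/mxmoduleP=> g gG; rewrite /boundaries.
rewrite (eqmxMr _ (genmxE _)) genmxE -mulmxA boundary_mx_act mulmxA submxMr //.
exact: (mxmoduleP (faces_mx_module k.+1)).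
Qed.

(* Cycles modulo boundaries, in reduced degree k - 1. *)
Definition homology_repr (k : nat) :=
  section_repr (boundaries_module k) (cycles_module k).

End Action.
End OrderComplex.

(* The fixed vectors are the isotypic component of the trivial representation,
   whose dimension is its multiplicity; [triv_mult_char] is the corresponding
   inner product of characters. *)
Definition triv_mult (gT : finGroupType) (G : {group gT}) (n : nat)
    (rG : mx_representation rat G n) : nat :=
  \rank (rfix_mx rG G).

Lemma mxtrace_idem (F : fieldType) n (e : 'M[F]_n) :
  (e *m e = e -> \tr e = (\rank e)%:R)%R.
Proof.
move=> ee; rewrite -{1}(mulmx_base e) mxtrace_mulC.
suff -> : (row_base e *m col_base e = 1%:M)%R by rewrite mxtrace1.
apply: (row_full_inj (col_base_full e)); apply: (row_free_inj (row_base_free e)).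
by rewrite /= mulmx1 mulmx_base mulmxA mulmx_base -mulmxA mulmx_base.
Qed.

Lemma triv_mult_char gT (G : {group gT}) n (rG : mx_representation rat G n) :
  ((triv_mult rG)%:R = #|G|%:R^-1 * \sum_(g in G) \tr (rG g) :> rat)%R.
Proof.
have cG0 : (#|G|%:R != 0 :> rat)%R by rewrite pnatr_eq0 -lt0n cardG_gt0.
pose e := (#|G|%:R^-1 *: \sum_(g in G) rG g)%R.
have e_fix h : h \in G -> (e *m rG h = e)%R.
  move=> Gh; rewrite -scalemxAl mulmx_suml; congr (_ *: _)%R.
  rewrite [RHS](reindex_inj (mulIg h)) /=; apply: eq_big => g.
    by rewrite groupMr.
  by move=> Gg; rewrite repr_mxM.
have fix_e m (W : 'M_(m, n)) : (W <= rfix_mx rG G)%MS -> (W *m e = W)%R.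
  move/rfix_mxP=> fixW; rewrite -scalemxAr mulmx_sumr.
  rewrite (eq_bigr (fun=> W)) => [|g Gg]; last exact: fixW.
  by rewrite sumr_const -scaler_nat scalerA mulVf // scale1r.
have e_sub : (e <= rfix_mx rG G)%MS by apply/rfix_mxP.
have <- : (\tr e = #|G|%:R^-1 * \sum_(g in G) \tr (rG g))%R.
  by rewrite mxtraceZ raddf_sum.
rewrite mxtrace_idem ?fix_e //; congr (_%:R)%R; apply: eqmx_rank.
apply/andP; split; last exact: e_sub.
by rewrite -[X in (X <= _)%MS](fix_e _ (rfix_mx rG G)) // submxMl.
Qed.

Fact Omega_display : Order.disp_t.
Proof. exact: Order.Disp tt tt. Qed.

Section OrderedSetPartitions.

Variable n : nat.

(* [n] is 'I_n, with i standing for i + 1. *)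
Definition is_osp (s : seq {set 'I_n}) : bool :=
  [&& set0 \notin s, pairwise (fun B C : {set 'I_n} => [disjoint B & C]) s
    & \bigcup_(B <- s) B == [set: 'I_n]].

(* Bounding the number of blocks by n, which makes the type finite, loses
   nothing: the blocks are nonempty and disjoint. *)
Definition osp := {s : n.-bseq {set 'I_n} | is_osp s}.

Definition blocks (x : osp) : seq {set 'I_n} := val x.

Definition merge_at (i : nat) (s : seq {set 'I_n}) : seq {set 'I_n} :=
  take i s ++ (nth set0 s i :|: nth set0 s i.+1) :: drop i.+2 s.

Definition merge_rel : rel osp := fun x y =>
  [exists i : 'I_n, (i.+1 < size (blocks x)) && (blocks y == merge_at i (blocks x))].

Definition osp_le : rel osp := connect merge_rel.

Lemma blocks_inj : injective blocks.
Proof. by move=> x y /val_inj/val_inj. Qed.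

Lemma size_merge_at i s : i.+1 < size s -> (size (merge_at i s)).+1 = size s.
Proof.
move=> lt_i; rewrite size_cat /= size_drop size_takel; last by rewrite 2?ltnW.
by rewrite -!addSnnS -addSn subnKC.
Qed.

Lemma osp_le_size x y : osp_le x y -> (x == y) || (size (blocks y) < size (blocks x)).
Proof.
case/connectP=> p + ->{y}; elim: p x => [|z p IHp] x /=; first by rewrite eqxx.
case/andP=> /existsP[i /andP[lt_i /eqP z_x]] /IHp.
have lt_z : size (blocks z) < size (blocks x) by rewrite z_x size_merge_at.
by case/predU1P=> [<- | lt]; rewrite ?lt_z ?(ltn_trans lt lt_z) orbT.
Qed.

Lemma osp_le_refl : reflexive osp_le.
Proof. exact: connect0. Qed.

Lemma osp_le_trans : transitive osp_le.
Proof. exact: connect_trans. Qed.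

Lemma osp_le_anti : antisymmetric osp_le.
Proof.
move=> x y /andP[/osp_le_size/predU1P[// | lt_yx] /osp_le_size].
by case/predU1P=> // lt_xy; have := ltn_trans lt_xy lt_yx; rewrite ltnn.
Qed.

(* [None] is the adjoined minimum. *)
Definition Omega : predArgType := option osp.
HB.instance Definition _ := Finite.on Omega.

Definition Omega_le : rel Omega := fun x y =>
  match x, y with
  | None, _ => true
  | Some _, None => false
  | Some p, Some q => osp_le p q
  end.

Lemma Omega_le_refl : reflexive Omega_le.
Proof. by case=> //= p; apply: osp_le_refl. Qed.

Lemma Omega_le_anti : antisymmetric Omega_le.
Proof. by case=> [p|] [q|] //= /osp_le_anti ->. Qed.

Lemma Omega_le_trans : transitive Omega_le.
Proof. by case=> [q|] [p|] [r|] //=; apply: osp_le_trans. Qed.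

HB.instance Definition _ := Order.Le_isPOrder.Build Omega_display Omega
  Omega_le_refl Omega_le_anti Omega_le_trans.

Definition crk (x : Omega) : nat := n - rk x.

(* The last two sets consist of the minimum and of the maximum. *)
Definition Omega_sel (T : {fset nat}) : {set Omega} :=
  [set x | crk x \in T] :|: [set None] :|: [set x | [forall y, (y <= x)%O]].

Lemma osp_act_subproof (x : osp) (s : 'S_n) :
  is_osp [bseq of map (fun B : {set 'I_n} => s @: B) (val x)].
Proof.
have inj := @perm_inj _ s; case: x => x /= /and3P[x0 xd /eqP xT]; apply/and3P; split.
- apply: contra x0 => /mapP[B Bx /esym/eqP].
  by rewrite imset_eq0 => /eqP <-.
- rewrite pairwise_map; apply: sub_pairwise xd => B C /=.
  by rewrite imset_disjoint.
rewrite big_map -(big_morph (fun B : {set 'I_n} => s @: B) (imsetU _) (imset0 _)) xT.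
by apply/eqP/setP=> i; rewrite inE -(permKV s i) imset_f ?inE.
Qed.

(* Permutations compose from left to right, so this is a right action. *)
Definition osp_act (x : osp) (s : 'S_n) : osp :=
  exist (fun t : n.-bseq {set 'I_n} => is_osp t) _ (osp_act_subproof x s).

Lemma blocks_act x s : blocks (osp_act x s) = map (fun B : {set 'I_n} => s @: B) (blocks x).
Proof. by []. Qed.

Lemma osp_act1 x : osp_act x 1 = x.
Proof.
apply: blocks_inj; rewrite blocks_act map_id_in // => B _.
by rewrite (eq_imset _ (@perm1 _)) imset_id.
Qed.

Lemma osp_actM x s t : osp_act x (s * t) = osp_act (osp_act x s) t.
Proof.
apply: blocks_inj; rewrite !blocks_act -map_comp; apply: eq_map => B /=.
by rewrite -imset_comp; apply: eq_imset => i; rewrite permM.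
Qed.

Lemma merge_rel_act x y s : merge_rel x y -> merge_rel (osp_act x s) (osp_act y s).
Proof.
case/existsP=> i /andP[lt_i /eqP y_x]; apply/existsP; exists i.
rewrite !blocks_act size_map lt_i y_x /merge_at map_cat /= map_take map_drop.
by rewrite imsetU !(nth_map set0) // ltnW.
Qed.

Lemma osp_le_act x y s : osp_le (osp_act x s) (osp_act y s) = osp_le x y.
Proof.
have homo z t u : osp_le z t -> osp_le (osp_act z u) (osp_act t u).
  case/connectP=> p + ->{t}; elim: p z => [|t p IHp] z /=; first by rewrite osp_le_refl.
  by case/andP=> zt /IHp; apply: connect_trans; apply/connect1/merge_rel_act.
apply/idP/idP=> [/(homo _ _ s^-1) | /homo//].
by rewrite -!osp_actM mulgV !osp_act1.
Qed.

Definition Omega_act (x : Omega) (s : 'S_n) : Omega := omap (osp_act^~ s) x.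

Lemma Omega_act1 x : Omega_act x 1 = x.
Proof. by case: x => //= x; rewrite osp_act1. Qed.

Lemma Omega_actM x s t : Omega_act x (s * t) = Omega_act (Omega_act x s) t.
Proof. by case: x => //= x; rewrite osp_actM. Qed.

Canonical Omega_action := TotalAction Omega_act1 Omega_actM.

Lemma Omega_le_act s x y :
  (Omega_action x s <= Omega_action y s)%O = (x <= y)%O.
Proof. by case: x y => [x|] [y|] //=; apply: osp_le_act. Qed.

Lemma Omega_sel_act T s x : (Omega_action x s \in Omega_sel T) = (x \in Omega_sel T).
Proof.
rewrite !inE /crk rk_act; last exact: Omega_le_act.
congr (_ || _ || _); first by case: x.
exact: (greatest_act Omega_le_act).
Qed.

Lemma Omega_proper_act T s x :
  (Omega_action x s \in proper_part (Omega_sel T)) = (x \in proper_part (Omega_sel T)).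
Proof. by apply: proper_part_act; [apply: Omega_le_act | apply: Omega_sel_act]. Qed.

(* The order complex of the proper part of Omega_n(T) has dimension #|T| - 1
   for T contained in [n - 1], so this is its top reduced homology. *)
Definition Omega_homology (T : {fset nat}) :=
  homology_repr Omega_le_act (Omega_proper_act T) #|` T|.

Definition fix_last : {group 'S_n} := 'C([set i : 'I_n | i.+1 == n :> nat] | 'P)%G.

Definition b (T : {fset nat}) : nat := triv_mult (Omega_homology T).

Definition b' (T : {fset nat}) : nat :=
  triv_mult (subg_repr (Omega_homology T) (subsetT fix_last)).

Definition gamma (T : {fset nat}) : int := ((b' T)%:Z - (b T)%:Z)%R.

End OrderedSetPartitions.

(* Main.v *)
(* Top-degree cycles of the order complex are the functions on chains of corank
   set T whose sum over the chains sharing all elements but one is always 0.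
   The fixed ones are functions on orbits of chains. An ordered set partition x
   is encoded by its ranking function, sending a to the number of elements in
   earlier blocks; its set of nonzero values determines the orbit of x under
   S_n, and coarsening composes the ranking function with a floor. So S_n-orbits
   of chains are flags A_r > ... > A_1 of subsets of {1, ..., n-1} with
   cardinals T, and for S_{n-1} there is in addition a mark in {0} u A_r, the
   value at n.

   To compute the dimension of the cycles on flags, order each class of flags
   that share all members but one. A cycle is determined by its values on the
   descent flags, those that are least in none of their classes, and conversely
   all values on them are possible: summing over A_r maps the cycles in the
   A_i, i < r, with A_r fixed, to cycles on flags (A_{r-1}, ..., A_1), and
   counting minimal extensions of descent flags shows that it is onto. This
   gives the recursions
     f(N, T) = C(N, t) f(t, T') - f(N, T'),
     f'(N, T) = (t + 1) C(N, t) f(t, T') - f'(N, T'),  t = max T, T' = T \ t,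
   for b_{N+1} and b'_{N+1}; f' = (N + 1) f(N, T) - N f(N - 1, T) follows. *)

From mathcomp Require Import all_boot all_order all_fingroup all_algebra.
From mathcomp Require Import mxrepresentation finmap zify.
Require Import Defs.

Set Implicit Arguments.
Unset Strict Implicit.
Unset Printing Implicit Defensive.

Import Order.TTheory GRing.Theory Num.Theory.
Import GroupScope.
Local Open Scope nat_scope.

(** * Flags of subsets *)

Section Extremal.

Variable I : finType.
Implicit Types (A B U : {set I}) (rho : I -> nat).

(** Exchanging [a] for [b] would keep [B] inside the set and lower its [rho]-sum. For injective
    [rho] and [A] between [B] and [U], no descent means that [A] is least among the sets of its size
    there. *)
Definition descent rho B A U : bool :=
  [exists a in A :\: B, exists b in U :\: A, rho b < rho a].

Lemma descentPn rho B A U :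
  reflect (forall a b, a \in A -> a \notin B -> b \in U -> b \notin A -> rho a <= rho b)
          (~~ descent rho B A U).
Proof.
apply: (iffP idP) => [nd a b aA aB bU bA | H].
  rewrite leqNgt; apply: contra nd => lt_ba; apply/exists_inP; exists a; first by rewrite inE aB.
  by apply/exists_inP; exists b; rewrite // inE bA.
apply/exists_inP=> -[a /setDP[aA aB] /exists_inP[b /setDP[bU bA]]].
by rewrite ltnNge H.
Qed.

(** Greedy choice: elements of [U] are added one at a time, each of least [rho] among those left. *)
Lemma min_extension rho B U k :
  B \subset U -> #|B| <= k <= #|U| ->
  exists A, [/\ B \subset A, A \subset U, #|A| = k & ~~ descent rho B A U].
Proof.
move=> sBU; elim: k => [|k IHk] /andP[leBk lekU].
  exists B; split=> //; first by apply/eqP; rewrite -leqn0.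
  by apply/descentPn=> a b ->.
have [eBk | neBk] := eqVneq #|B| k.+1.
  by exists B; split=> //; apply/descentPn=> a b ->.
have [|A [sBA sAU cA /descentPn nd]] := IHk.
  by rewrite -ltnS ltn_neqAle neBk leBk /= ltnW.
have /card_gt0P[c0 c0UA] : 0 < #|U :\: A| by rewrite cardsDS // cA subn_gt0.
case: (arg_minnP rho c0UA) => c /setDP[cU cnA] min_c.
exists (c |: A); split.
- by rewrite (subset_trans sBA) ?subsetU1.
- by rewrite subUset sub1set cU.
- by rewrite cardsU1 cnA cA.
apply/descentPn=> a b; rewrite !inE => /predU1P[->|aA] aB bU /norP[bc bA].
  by apply: min_c; apply/setDP.
exact: nd.
Qed.

(** The two set differences have the same size, and each element of [A' :\: A] lies above each
    element of [A :\: A']; the greatest [rho] on the latter separates the sums. *)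
Lemma min_extension_strict rho B A A' U :
  injective rho -> ~~ descent rho B A U -> B \subset A' -> A' \subset U -> #|A'| = #|A| ->
  A' != A -> \sum_(a in A) rho a < \sum_(a in A') rho a.
Proof.
move=> rho_inj /descentPn nd sBA' sA'U eqc neA.
have eqcD : #|A :\: A'| = #|A' :\: A|.
  by have := cardsID A' A; have := cardsID A A'; rewrite (setIC A' A); lia.
have /card_gt0P[a0 a0D] : 0 < #|A :\: A'|.
  rewrite card_gt0; apply: contra neA; rewrite setD_eq0 => sAA'.
  by rewrite eq_sym eqEcard sAA' eqc leqnn.
case: (arg_maxnP rho a0D) => a /setDP[aA aA'] max_a.
rewrite (big_setID A') /= [in leqRHS](big_setID A) /= setIC ltn_add2l.
apply: (@leq_ltn_trans (#|A :\: A'| * rho a)).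
  by rewrite -sum_nat_const; apply: leq_sum => x /max_a.
apply: (@leq_trans (#|A' :\: A| * (rho a).+1)).
  by rewrite eqcD ltn_mul2l -eqcD ltnSn andbT; apply/card_gt0P; exists a0.
rewrite -sum_nat_const; apply: leq_sum => b /setDP[bA' bA].
have aB : a \notin B by apply: contra aA' => /(subsetP sBA').
rewrite ltn_neqAle nd ?(subsetP sA'U) // andbT.
by apply: contra bA => /eqP/rho_inj <-.
Qed.

End Extremal.

Lemma sum_fibers (X Z : eqType) (s : seq X) (t : seq Z) (h : X -> Z) (P : pred Z) (g : X -> rat) :
  uniq t -> (forall x, x \in s -> h x \in t) ->
  (\sum_(z <- t | P z) \sum_(x <- s | h x == z) g x = \sum_(x <- s | P (h x)) g x)%R.
Proof.
move=> t_uniq ht; rewrite (exchange_big_dep predT) //= [RHS]big_mkcond; apply: eq_big_seq => x xs.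
rewrite big_mkcond (bigD1_seq (h x)) ?ht //= eqxx andbT big1 ?addr0 // => z.
by rewrite eq_sym => /negPf ->; rewrite andbF.
Qed.

Lemma sum_fibers0 (X Z : eqType) (s : seq X) (h : X -> Z) (P : pred Z) (g : X -> rat) :
  (forall x0, x0 \in s -> \sum_(x <- s | h x == h x0) g x = 0)%R ->
  (\sum_(x <- s | P (h x)) g x = 0)%R.
Proof.
move=> H; rewrite -(@sum_fibers _ _ s (undup (map h s))) ?undup_uniq // => [|x xs]; last first.
  by rewrite mem_undup map_f.
rewrite big_seq_cond big1 // => z; rewrite mem_undup => /andP[/mapP[x0 xs ->] _].
exact: H.
Qed.

(** * Flags with marks, their faces and cycles *)

Definition del (X : Type) (i : nat) (s : seq X) : seq X := take i s ++ drop i.+1 s.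

(* Data attached to the largest member of a flag: [mok q A] says that q is a
   possible mark of A, [mfl B q] is the mark that q induces on a smaller set B,
   and [mrho q] is the order on I used to compare flags of mark q. By [mrho_top],
   the last element in this order is lost when q stops being a possible mark. *)
Record marks (I : finType) := Marks {
  mark :> finType;
  mnu : mark -> nat;
  mok : mark -> {set I} -> bool;
  mfl : {set I} -> mark -> mark;
  mrho : mark -> I -> nat;
  mfl_ok : forall (B : {set I}) q, mok (mfl B q) B;
  mfl_id : forall (B : {set I}) q, mok q B -> mfl B q = q;
  mfl_lt : forall (B : {set I}) q, ~~ mok q B -> mnu (mfl B q) < mnu q;
  mfl_comp : forall (A B : {set I}) q, B \subset A -> mfl B (mfl A q) = mfl B q;
  mok_mono : forall (A B : {set I}) q, B \subset A -> mok q B -> mok q A;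
  mrho_inj : forall q, injective (mrho q);
  mrho_top : forall (A B : {set I}) q, B \subset A -> mok q A -> ~~ mok q B ->
    exists2 a, a \in A :\: B & forall b, mrho q b <= mrho q a }.

Section Marks.

Variable I : finType.

(** The case of the full symmetric group: one mark, possible for every set, so that only the order
    remains. *)
Program Definition unit_marks (rho : I -> nat) (rho_inj : injective rho) : marks I :=
  @Marks I unit (fun _ => 0) (fun _ _ => true) (fun _ q => q) (fun _ => rho)
   _ _ _ _ _ _ _.

(** Once the first member and its mark are chosen, the tail is an unmarked flag; it keeps the order
    attached to [q]. *)
Definition submarks (M : marks I) (q : M) : marks I := unit_marks (@mrho_inj I M q).

Implicit Types (M : marks I) (U A B : {set I}) (l : seq {set I}) (ks : seq nat).

Local Notation hd := (head set0).

Definition layer M U k : {set M * {set I}} :=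
  [set p : M * {set I} | [&& p.2 \subset U, #|p.2| == k & mok p.1 p.2]].

(* Flags list their largest member first, so ks is decreasing. *)
Fixpoint flags ks M U : seq (M * seq {set I}) :=
  match ks with
  | [::] => [seq (q, [::]) | q <- enum M & mok q set0]
  | k :: ks' => [seq (p.1, p.2 :: y.2) | p <- enum (layer M U k), y <- flags ks' (submarks p.1) p.2]
  end.

(* That the flag is least in none of its classes. For the class where the first
   member varies, the least flag has a mark that is already one of the next member. *)
Fixpoint all_descents l M U (q : M) : bool :=
  if l is A :: l' then
    (~~ mok q (hd l') || descent (mrho q) (hd l') A U) && @all_descents l' (submarks q) A tt
  else true.

(** On a flag the mark can change only for [i = 0]: omitting a later member keeps the head, for
    which the mark is already possible. *)
Definition face M (i : nat) (x : M * seq {set I}) : M * seq {set I} :=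
  (mfl (hd (del i x.2)) x.1, del i x.2).

Definition flag_cycle ks M U (g : M * seq {set I} -> rat) : Prop :=
  forall i, i < size ks -> forall x0, x0 \in flags ks M U ->
    (\sum_(x <- flags ks M U | face i x == face i x0) g x = 0)%R.

Definition descent_flags ks M U := [seq x <- flags ks M U | all_descents x.2 U x.1].

Lemma mem_flags ks M U (x : M * seq {set I}) :
  (x \in flags ks M U) =
  [&& mok x.1 (hd x.2), map (fun A => #|pred_of_set A|) x.2 == ks & path (fun A B => B \subset A) U x.2].
Proof.
elim: ks M U x => [|k ks IHks] M U [q l] /=.
  apply/mapP/idP => [[q1] | ].
    by rewrite mem_filter => /andP[okq _] [-> ->] /=; rewrite okq.
  case: l => [|A l] /and3P[] //= okq _ _; exists q => //.
  by rewrite mem_filter okq mem_enum.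
apply/allpairsPdep/idP => [[p [[[] l1]]] | ].
  rewrite mem_enum inE (IHks (submarks p.1) p.2 (tt, l1)) /= => -[/and3P[sU /eqP cA okp] /andP[/eqP <- pth]] [-> ->] /=.
  by rewrite okp cA eqxx sU.
case: l => [|A l] /and3P[] //= okq /eqP[cA cl] /andP[sU pth].
exists (q, A), (tt, l); split=> //; first by rewrite mem_enum inE /= sU cA eqxx.
by rewrite (IHks (submarks q) A (tt, l)) /= cl eqxx.
Qed.

Lemma flags_uniq ks M U : uniq (flags ks M U).
Proof.
elim: ks M U => [|k ks IHks] M U /=.
  by rewrite map_inj_uniq ?filter_uniq -?enumT ?enum_uniq // => p q [].
apply: allpairs_uniq_dep => [|p _|]; [exact: enum_uniq | exact: IHks |].
move=> [p [[] l]] [p' [[] l']] _ _ /= [e1 e2 ->].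
by case: p p' e1 e2 => q A [q' A'] /= -> ->.
Qed.

Lemma sum_flags_cons (k : nat) ks M U (P : pred (M * seq {set I})) (F : M * seq {set I} -> rat) :
  (\sum_(x <- flags (k :: ks) M U | P x) F x =
   \sum_(p in layer M U k) \sum_(y <- flags ks (submarks p.1) p.2 | P (p.1, p.2 :: y.2))
      F (p.1, p.2 :: y.2))%R.
Proof.
rewrite big_mkcond big_allpairs_dep /= big_enum /=; apply: eq_bigr => p _.
by rewrite -big_mkcond.
Qed.

Lemma face_eqS M i (p x0 : M * {set I}) (y y0 : unit * seq {set I}) (k : nat) U :
   p \in layer M U k -> x0 \in layer M U k ->
  (face i.+1 (p.1, p.2 :: y.2) == face i.+1 (x0.1, x0.2 :: y0.2)) =
   (p == x0) && (face (M := submarks x0.1) i y == face (M := submarks x0.1) i y0).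
Proof.
rewrite !inE => /and3P[_ _ okp] /and3P[_ _ okx].
case: p x0 y y0 okp okx => q A [q0 A0] [[] l] [[] l0] /= okp okx.
by rewrite /face /= !mfl_id // !xpair_eqE /= eqseq_cons andbA.
Qed.

Lemma sum_face_cons (k : nat) ks M U (p : M * {set I}) i (y0 : unit * seq {set I}) (g : M * seq {set I} -> rat) :
  p \in layer M U k ->
  (\sum_(x <- flags (k :: ks) M U | face i.+1 x == face i.+1 (p.1, p.2 :: y0.2)) g x =
   \sum_(y <- flags ks (submarks p.1) p.2 | face i y == face (M := submarks p.1) i y0) g (p.1, p.2 :: y.2))%R.
Proof.
move=> pL; rewrite sum_flags_cons (bigD1 p) //= [X in (_ + X)%R]big1 ?addr0 => [|p2 /andP[p2L np]].
  by apply: eq_bigl => y; rewrite (face_eqS _ _ _ pL pL) eqxx.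
by apply: big_pred0 => y; rewrite (face_eqS _ _ _ p2L pL) (negPf np).
Qed.

End Marks.

Arguments flag_cycle {I} ks M U g.

(** * Cycles are parametrized by their values on descent flags *)

Section Param.

Variable I : finType.
Implicit Types (M : marks I) (U A B : {set I}) (l : seq {set I}) (ks : seq nat).
Local Notation hd := (head set0).

Lemma flags_hd ks M U q l : (q, l) \in flags ks M U -> hd l \subset U.
Proof.
rewrite mem_flags => /and3P[_ _]; case: l => [|A l] /=; first by rewrite sub0set.
by case/andP.
Qed.

Lemma mem_flags_cons (k : nat) ks M U q A l :
  ((q, A :: l) \in flags (k :: ks) M U) =
  ((q, A) \in layer M U k) && ((tt, l) \in flags ks (submarks q) A).
Proof.
rewrite mem_flags (mem_flags ks (M := submarks q) A (tt, l)) inE /= eqseq_cons -!andbA.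
case: (A \subset U); case: (#|A| == k); case: (mok q A); rewrite /= ?andbF //.
Qed.

Lemma flags_consP (k : nat) ks M U x :
  x \in flags (k :: ks) M U ->
  exists p l, [/\ x = (p.1, p.2 :: l), p \in layer M U k & (tt, l) \in flags ks (submarks p.1) p.2].
Proof.
case/allpairsPdep=> p [[[] l]] [pL lP ->]; exists p, l; split=> //.
by move: pL; rewrite mem_enum.
Qed.

Lemma path_gtn_weak a b s : a <= b -> path gtn a s -> path gtn b s.
Proof. by case: s => //= c s leab /andP[lt ->]; rewrite (leq_trans lt). Qed.

(** With [surj_on], this makes the number of descent flags the dimension of the space of flag
    cycles. *)
Definition inj_on ks M U := forall g, flag_cycle ks M U g ->
  (forall x, x \in descent_flags ks M U -> g x = 0%R) -> forall x, x \in flags ks M U -> g x = 0%R.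

Definition surj_on ks M U := forall f : M * seq {set I} -> rat,
  exists2 g, flag_cycle ks M U g & forall x, x \in descent_flags ks M U -> g x = f x.


(** All cycle equations but those in which the first member varies; the first member is then a mere
    parameter. *)
Definition lower_cycle (k : nat) ks M U (g : M * seq {set I} -> rat) := forall i, i < size ks ->
  forall x0, x0 \in flags (k :: ks) M U ->
  (\sum_(x <- flags (k :: ks) M U | face i.+1 x == face i.+1 x0) g x = 0)%R.

Arguments lower_cycle : clear implicits.

Lemma lower_cycleP (k : nat) ks M U (g : M * seq {set I} -> rat) :
  lower_cycle k ks M U g <-> (forall p, p \in layer M U k ->
    flag_cycle ks (submarks p.1) p.2 (fun y => g (p.1, p.2 :: y.2))).
Proof.
split=> H.
  move=> p pL i lti [[] l] lF; have := H i lti (p.1, p.2 :: l).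
  rewrite (sum_face_cons _ _ (tt, l)) //; apply.
  by rewrite mem_flags_cons lF andbT; case: p pL {lF}.
move=> i lti x0 /flags_consP[p [l [-> pL lF]]].
by rewrite (sum_face_cons _ _ (tt, l)) //; apply: H.
Qed.

Lemma face0 M q A l : face (M := M) 0 (q, A :: l) = (mfl (hd l) q, l).
Proof. by rewrite /face /del /= drop0. Qed.

Lemma flag_cycleE (k : nat) ks M U g : flag_cycle (k :: ks) M U g <->
  lower_cycle k ks M U g /\ (forall x0, x0 \in flags (k :: ks) M U ->
    (\sum_(x <- flags (k :: ks) M U | face 0 x == face 0 x0) g x = 0)%R).
Proof.
split=> [H | [H0 H] [|i] lti]; [split=> [i lti|] | exact: H | exact: H0].
  exact: (H i.+1).
exact: (H 0).
Qed.

(* Downward induction on the first member and the mark, ordered by mu: at a flag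
   that is least in its class, the vanishing sum leaves a single term. *)
Lemma inj_step (k : nat) ks M U :
  (forall q A, #|A| = k -> inj_on ks (@submarks I M q) A) -> inj_on (k :: ks) M U.
Proof.
move=> IH g /flag_cycleE[/lower_cycleP g0 gface] gD.
(* [W] exceeds every sum of [mrho] over a set, so [mu] is lexicographic: first the mark through
   [mnu], then the set. *)
pose W := (\sum_(q : M) \sum_(a : I) mrho q a).+1.
pose mu (p : M * {set I}) := mnu p.1 * W + \sum_(a in p.2) mrho p.1 a.
have ltW (p : M * {set I}) : \sum_(a in p.2) @mrho I M p.1 a < W.
  rewrite ltnS (bigD1 p.1) //= (leq_trans _ (leq_addr _ _)) //.
  by rewrite [leqLHS]big_mkcond; apply: leq_sum => a _; case: ifP.
suff claim d p : p \in layer M U k -> \sum_(p' : M * {set I}) mu p' - mu p < d ->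
    forall l, (tt, l) \in flags ks (submarks p.1) p.2 -> g (p.1, p.2 :: l) = 0%R.
  by move=> x /flags_consP[p [l [-> pL lF]]]; apply: (claim _ p pL (ltnSn _)).
elim: d p => // d IHd p pL ltd l lF.
have cardp : #|p.2| = k by move: pL; rewrite inE => /and3P[_ /eqP].
apply: (IH p.1 p.2 cardp _ (g0 p pL) _ (tt, l) lF) => {lF} [] [[] {}l] /=.
rewrite mem_filter /= => /andP[dl lF].
have xF : (p.1, p.2 :: l) \in flags (k :: ks) M U.
  by rewrite mem_flags_cons lF andbT; case: p pL {ltd cardp dl lF}.
have [xD | ] := boolP ((p.1, p.2 :: l) \in descent_flags (k :: ks) M U); first exact: gD.
rewrite mem_filter xF andbT /= dl andbT negb_or negbK => /andP[okp nd].
have := gface _ xF; rewrite big_mkcond /= (bigD1_seq _ xF (flags_uniq _ _ _)) /= eqxx.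
rewrite big_seq_cond big1 ?addr0 // => x /andP[/flags_consP[p' [l' [-> p'L l'F]]] neqx].
case: eqP => //; rewrite !face0 (mfl_id okp) => -[eq_q eq_l].
subst l'.
have ltmu : mu p < mu p'.
  (* A competitor whose mark is possible for [hd l] has the same mark and a larger set. Otherwise
     its mark drops strictly to that of [p], so its [mnu] is larger. *)
  rewrite /mu; have [ok' | nok'] := boolP (mok p'.1 (hd l)).
    have epq : p'.1 = p.1 by rewrite -eq_q mfl_id.
    rewrite epq ltn_add2l; apply: (min_extension_strict (@mrho_inj _ _ _) nd).
    - by have := flags_hd l'F.
    - by move: p'L; rewrite inE => /and3P[].
    - by move: p'L; rewrite inE cardp => /and3P[_ /eqP ->].
    by apply: contraNneq neqx => ->; rewrite epq eqxx.
  have := mfl_lt nok'; rewrite eq_q => ltnu.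
  apply: (@leq_trans ((mnu p.1).+1 * W)); first by rewrite mulSn addnC ltn_add2r ltW.
  by rewrite (leq_trans _ (leq_addr _ _)) // leq_mul2r ltnu orbT.
apply: IHd => //; rewrite -ltnS; apply: leq_trans ltd.
have lemu : mu p' <= \sum_(p'' : M * {set I}) mu p'' by rewrite (bigD1 p') //= leq_addr.
by rewrite ltnS ltn_sub2l // (leq_trans ltmu).
Qed.


Lemma face0_flags (k : nat) ks M U x :
  x \in flags (k :: ks) M U -> face 0 x \in flags ks M U.
Proof.
case/flags_consP=> p [l [-> pL lF]]; rewrite face0 mem_flags /= mfl_ok /=.
have := flags_hd lF; move: lF; rewrite (mem_flags _ (M := submarks p.1) _ (tt, l)) /=.
case/andP=> -> /=; move: pL; rewrite inE => /and3P[sU _ _].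
by case: l => //= B l /andP[_ ->] sBA; rewrite (subset_trans sBA).
Qed.

Lemma hd_del_sub i l A : path (fun A B : {set I} => B \subset A) A l -> hd (del i l) \subset hd l.
Proof.
case: l => [|B l] /=; first by rewrite sub0set.
case/andP=> _; case: i => [|i] //=; rewrite /del /= drop0.
by case: l => [|C l] /=; [rewrite sub0set | case/andP].
Qed.

(** The simplicial identity; the marks agree by [mfl_comp]. *)
Lemma face_face0 (k : nat) ks M U i x :
  x \in flags (k :: ks) M U -> face i (face 0 x) = face 0 (face i.+1 x).
Proof.
case/flags_consP=> p [l [-> pL lF]]; rewrite face0.
have sh := flags_hd lF; move: lF; rewrite (mem_flags _ (M := submarks p.1) _ (tt, l)) /=.
case/andP=> _ /(hd_del_sub i) sd.
have -> : face i.+1 (p.1, p.2 :: l) = (mfl p.2 p.1, p.2 :: del i l) by [].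
by rewrite face0 /face /= !mfl_comp // (subset_trans sd).
Qed.

Section Step.

Variables (k : nat) (ks : seq nat) (M : marks I) (U : {set I}).
Hypotheses (lek : k <= #|U|) (ks_path : path gtn k ks).
Hypothesis sub_inj : forall (q : M) A, #|A| = k -> inj_on ks (submarks q) A.
Hypothesis sub_surj : forall (q : M) A, #|A| = k -> surj_on ks (submarks q) A.
Hypothesis low_inj : inj_on ks M U.

Let X := flags (k :: ks) M U.
Let Y := flags ks M U.
Let D := descent_flags (k :: ks) M U.
Let DY := descent_flags ks M U.

Definition dlow (x : M * seq {set I}) : bool :=
  if x.2 is A :: l then @all_descents I l (submarks x.1) A tt else true.

Let D0 := [seq x <- X | dlow x].
Let Mi := [seq x <- D0 | ~~ all_descents x.2 U x.1].

(** Summation over the first member; its vanishing supplies the equations missing from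
    [lower_cycle]. *)
Definition push (g : M * seq {set I} -> rat) (y : M * seq {set I}) : rat :=
  (\sum_(x <- X | face 0 x == y) g x)%R.

(** By [face_face0], a class under [face i] after the push collects whole classes under [face i.+1],
    on which [g] sums to zero. *)
Lemma push_cycle g : lower_cycle k ks M U g -> flag_cycle ks M U (push g).
Proof.
move=> gc i lti y0 y0Y; rewrite (@sum_fibers _ _ X Y (face 0) (fun y => face i y == face i y0)).
- transitivity (\sum_(x <- X | face 0 (face i.+1 x) == face i y0) g x)%R.
    rewrite big_seq_cond [RHS]big_seq_cond; apply: eq_bigl => x.
    by case xX: (x \in X); rewrite //= (face_face0 i xX).
  apply: (@sum_fibers0 _ _ X (face i.+1) (fun z => face 0 z == face i y0)) => x0 xX.
  exact: gc.
- exact: flags_uniq.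
by move=> x; apply: face0_flags.
Qed.

Lemma push0_cycle g : lower_cycle k ks M U g -> (forall y, y \in Y -> push g y = 0%R) ->
  flag_cycle (k :: ks) M U g.
Proof. by move=> gc g0; apply/flag_cycleE; split=> // x0 xX; apply/g0/face0_flags/xX. Qed.

(** Different first members impose no common equation, so surjectivity on tails is applied to each
    separately. *)
Lemma lift_lower_cycle (f : M * seq {set I} -> rat) :
  exists2 g, lower_cycle k ks M U g & forall x, x \in D0 -> g x = f x.
Proof.
have H (p : M * {set I}) : exists2 h : unit * seq {set I} -> rat,
   (p \in layer M U k -> flag_cycle ks (submarks p.1) p.2 h) &
   (p \in layer M U k -> forall y, y \in descent_flags ks (submarks p.1) p.2 -> h y = f (p.1, p.2 :: y.2)).
  have [pL | pL] := boolP (p \in layer M U k); last by exists (fun=> 0%R).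
  have cp : #|p.2| = k by move: pL; rewrite inE => /and3P[_ /eqP].
  by have [h hc hD] := sub_surj (q := p.1) cp (fun y => f (p.1, p.2 :: y.2)); exists h.
have {H}[h hc hD] := fin_all_exists2 H.
exists (fun x => if x.2 is A :: l then h (x.1, A) (tt, l) else 0%R).
  apply/lower_cycleP => p pL /=; move: (hc p pL); case: p pL => q A pL /= {}hc i lti x0 xF.
  by rewrite -[RHS](hc i lti x0 xF); apply: eq_bigr => -[[] l].
move=> x; rewrite mem_filter => /andP[dl /flags_consP[p [l [ex pL lF]]]].
move: dl; rewrite ex /dlow /= => dl; case: p pL lF dl {ex} => q A pL lF dl.
rewrite (hD _ pL (tt, l)) // mem_filter; apply/andP; split; [exact: dl | exact: lF].
Qed.

Lemma D_sub x : x \in X -> all_descents x.2 U x.1 -> dlow x.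
Proof. by case/flags_consP=> p [l [-> pL lF]] /andP[]. Qed.

Lemma D_D0 x : x \in D -> x \in D0.
Proof. by rewrite !mem_filter => /andP[dx xX]; rewrite xX (D_sub xX dx). Qed.

Lemma D_filter : D = [seq x <- D0 | all_descents x.2 U x.1].
Proof.
rewrite -filter_predI; apply: eq_in_filter => x xX /=.
by case dx: (all_descents _ _ _) => //=; rewrite (D_sub xX dx).
Qed.

Lemma size_D_Mi : size D + size Mi = size D0.
Proof. by rewrite D_filter size_filter [X in _ + X]size_filter count_predC. Qed.

Lemma size_D0 : size D0 = \sum_(p in layer M U k) size (descent_flags ks (submarks p.1) p.2).
Proof.
rewrite -sum1_size big_filter big_mkcond big_allpairs_dep /= big_enum /=.
apply: eq_bigr => p _; rewrite -big_mkcond -sum1_size big_filter.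
by apply: eq_bigl => -[[] l].
Qed.

(** A descent flag is extended by the least set [A] of size [k] between its head and [U], with the
    same mark. Being least in its class, the extension is no descent flag; its tail must keep its
    descents when [U] shrinks to [A]. *)
Lemma DY_sub_Mi : {subset DY <= map (face 0) Mi}.
Proof.
move=> [q l]; rewrite mem_filter /= => /andP[dl qlY].
have sh := flags_hd qlY; have := qlY; rewrite mem_flags /= => /and3P[okq /eqP cl pl].
have leh : #|hd l| <= k.
  move: cl ks_path; case: (l) => [|B l'] /=; first by rewrite cards0.
  by case: (ks) => //= k1 ks1 [-> _] /andP[/ltnW].
have [|A [sA sAU cA nd]] := min_extension (mrho q) sh (k := k); first by rewrite leh.
have okA : mok q A by apply: mok_mono okq.
apply/mapP; exists (q, A :: l); last by rewrite face0 mfl_id.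
have pAl : path (fun A B : {set I} => B \subset A) A l.
  by move: pl sA; case: (l) => //= B l' /andP[_ ->] ->.
rewrite !mem_filter /= mem_flags_cons inE /= sAU cA eqxx okA /=.
rewrite (mem_flags _ (M := submarks q) _ (tt, l)) /= cl eqxx pAl /= andbT.
rewrite negb_and negb_or negbK okq nd /= /dlow /=.
case: l dl cl pl pAl sA nd okq {qlY leh sh} => //= B l /andP[dB ->] cl /andP[sBU pl] /andP[sBA _] _ nd okB.
rewrite andbT.
have /card_gt0P[b0 b0AB] : 0 < #|A :\: B|.
  rewrite cardsDS // subn_gt0 cA; move: cl ks_path.
  by case: (ks) => //= k1 ks1 [-> _] /andP[].
have /setDP[b0A b0B] := b0AB.
(* If the condition at [B] may hold through the mark alone, the unmarked tail needs a true descent: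
   by [mrho_top] the last element of the order lies in [B :\: hd l], and [b0] precedes it. *)
have [okl | nokl] := boolP (mok q (hd l)); last first.
  have shB : hd l \subset B by case: (l) pl => [|C l'] /=; rewrite ?sub0set // => /andP[].
  have [a /setDP[aB anl] max_a] := mrho_top shB okB nokl.
  apply/exists_inP; exists a; first by rewrite inE aB anl.
  apply/exists_inP; exists b0 => //; rewrite ltn_neqAle max_a andbT.
  by apply: contra b0B => /eqP/mrho_inj ->.
move: dB; rewrite okl /= => /exists_inP[a aD /exists_inP[b /setDP[bU bB] ltba]].
apply/exists_inP; exists a => //; apply/exists_inP.
(* If [b] was not taken into [A], minimality of [A] puts [b0] no later than [b], so [b0] serves
   instead. *)
have [bA | bA] := boolP (b \in A); first by exists b; rewrite // inE bB.
exists b0 => //; apply: leq_ltn_trans ltba.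
by move/descentPn: nd; apply.
Qed.

(* Mi is the set of flags at which a value is left to be chosen; the matrix B of
   the sums of a basis indexed by Mi is square since minimal extension embeds DY
   in Mi, and has free rows by inj_step. *)
Lemma surj_step_count : surj_on (k :: ks) M U /\ size D + size DY = size D0.
Proof.
pose nM := size Mi; pose z := tnth (in_tuple Mi).
have zMi i : z i \in Mi by apply: mem_tnth.
have zD0 i : z i \in D0 by have := zMi i; rewrite mem_filter => /andP[].
have zX i : z i \in X by have := zD0 i; rewrite mem_filter => /andP[].
have D0_uniq : uniq D0 by rewrite filter_uniq ?flags_uniq.
have Mi_uniq : uniq Mi by rewrite filter_uniq.
have z_inj : injective z by apply/tuple_uniqP.
have /fin_all_exists2[e ec eD0] (i : 'I_nM) := lift_lower_cycle (fun x => (x == z i)%:R%R).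
pose B : 'M[rat]_(nM, size DY) := (\matrix_(i, j) push (e i) (tnth (in_tuple DY) j))%R.
pose comb (u : 'rV[rat]_nM) x := (\sum_i u 0 i * e i x)%R.
have comb_psi u y : push (comb u) y = (\sum_i u 0 i * push (e i) y)%R.
  by rewrite /push exchange_big /=; apply: eq_bigr => i _; rewrite mulr_sumr.
have comb_c u : lower_cycle k ks M U (comb u).
  move=> i lti x0 x0X; rewrite exchange_big /= big1 // => j _.
  by rewrite -mulr_sumr ec ?mulr0.
have comb_D u x : x \in D -> comb u x = 0%R.
  move=> xD; rewrite /comb big1 // => i _; rewrite eD0 ?D_D0 //.
  case: eqP => [ex | _]; last by rewrite mulr0.
  by have := zMi i; rewrite -ex mem_filter; move: xD; rewrite mem_filter => /andP[->].
have comb_DY u j : (u *m B)%R 0%R j = push (comb u) (tnth (in_tuple DY) j).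
  by rewrite comb_psi mxE; apply: eq_bigr => i _; rewrite mxE.
have low0 g : lower_cycle k ks M U g -> (forall j, push g (tnth (in_tuple DY) j) = 0%R) ->
    flag_cycle (k :: ks) M U g.
  move=> gc g0; apply: push0_cycle => //; apply: low_inj; first exact: push_cycle.
  by move=> x /(tnthP (in_tuple DY))[j ->].
(* A relation among the rows gives a lower cycle with zero push, hence a cycle. It vanishes on [D],
   hence everywhere, and its value at [z i] is the coefficient [u 0 i]. *)
have B_free : row_free B.
  apply: inj_row_free => u uB0; apply/rowP => i; rewrite mxE.
  have cu : flag_cycle (k :: ks) M U (comb u).
    by apply: low0 => // j; rewrite -comb_DY uB0 mxE.
  have := inj_step sub_inj cu (comb_D u) (zX i).
  rewrite /comb (bigD1 i) //= eD0 // eqxx mulr1 big1 ?addr0 // => j ne_ji.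
  by rewrite eD0 // (inj_eq z_inj) eq_sym (negPf ne_ji) mulr0.
have leYM : size DY <= nM.
  rewrite /nM -(size_map (face (M := M) 0) Mi); apply: uniq_leq_size DY_sub_Mi.
  by rewrite filter_uniq ?flags_uniq.
have eqYM : size DY = nM.
  by apply/eqP; rewrite eqn_leq leYM -(eqP B_free) rank_leq_col.
split; last by rewrite eqYM -size_D_Mi.
(* [g0] has the required values on [D]; a combination of the [e i], which vanish on [D], cancels its
   push. *)
move=> f; have [g0 g0c g0D] := lift_lower_cycle f.
pose w : 'rV[rat]_(size DY) := (\row_j push g0 (tnth (in_tuple DY) j))%R.
have B_full : row_full B by rewrite /row_full (eqP B_free) eqYM.
have := mulmxKpV (submx_full w B_full); set u := (w *m _)%R => uB.
exists (fun x => g0 x + comb (- u)%R x)%R => [|x xD]; last first.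
  by rewrite comb_D // addr0 g0D ?D_D0.
apply: low0 => [i lti x0 x0X | j].
  by rewrite big_split /= g0c // comb_c // addr0.
have -> : push (fun x => g0 x + comb (- u)%R x)%R (tnth (in_tuple DY) j) =
   (push g0 (tnth (in_tuple DY) j) + push (comb (- u)%R) (tnth (in_tuple DY) j))%R.
  by rewrite /push big_split.
by rewrite -comb_DY mulNmx uB !mxE subrr.
Qed.

End Step.

(** The hypothesis says that [ks] decreases strictly from a first entry at most [#|U|]. The
    induction uses the shorter list twice: inside each first member, for tails, and inside [U]
    itself, for pushed cycles. *)
Theorem descent_param ks M U : path gtn #|U|.+1 ks -> inj_on ks M U /\ surj_on ks M U.
Proof.
elim: ks M U => [|k ks IH] M U /=.
  move=> _; split=> [g _ g0 x xF | f]; last by exists f.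
  by apply: g0; rewrite mem_filter xF andbT; case/mapP: xF => q _ ->.
case/andP; rewrite ltnS => lek pk.
have low : path gtn #|U|.+1 ks by apply: path_gtn_weak pk; apply: leqW.
have sub (q : M) A : #|A| = k -> inj_on ks (submarks q) A /\ surj_on ks (submarks q) A.
  by move=> cA; apply: IH; rewrite cA; apply: path_gtn_weak pk.
have sinj (q : M) A cA := (sub q A cA).1; have ssurj (q : M) A cA := (sub q A cA).2.
have [linj _] := IH M U low.
by split; [apply: inj_step | have [] := surj_step_count lek pk sinj ssurj linj].
Qed.

Theorem size_descent_flags_cons (k : nat) ks M U : path gtn #|U|.+1 (k :: ks) ->
  size (descent_flags (k :: ks) M U) + size (descent_flags ks M U) =
  \sum_(p in layer M U k) size (descent_flags ks (submarks p.1) p.2).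
Proof.
rewrite /= => /andP[]; rewrite ltnS => lek pk.
have low : path gtn #|U|.+1 ks by apply: path_gtn_weak pk; apply: leqW.
have sub (q : M) A : #|A| = k -> inj_on ks (submarks q) A /\ surj_on ks (submarks q) A.
  by move=> cA; apply: descent_param; rewrite cA; apply: path_gtn_weak pk.
have sinj (q : M) A cA := (sub q A cA).1; have ssurj (q : M) A cA := (sub q A cA).2.
have [linj _] := descent_param M low.
by rewrite -size_D0; have [] := surj_step_count lek pk sinj ssurj linj.
Qed.

End Param.

(** * Counting descent flags *)

Section Counting.

Variable I : finType.
Implicit Types (U A B : {set I}) (l : seq {set I}) (ks : seq nat).
Local Notation hd := (head set0).

(* When ks is decreasing, this is the number of permutations of N letters with
   descent set ks. *)
Fixpoint unmarked_count (N : nat) (ks : seq nat) : int :=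
  if ks is k :: ks' then ('C(N, k)%:Z * unmarked_count k ks' - unmarked_count N ks')%R else 1%R.

(** The factor [k.+1] counts the marks of a set of size [k], which are its elements and 0; tails are
    unmarked. *)
Fixpoint marked_count (N : nat) (ks : seq nat) : int :=
  if ks is k :: ks' then ((k.+1 * 'C(N, k))%:Z * unmarked_count k ks' - marked_count N ks')%R else 1%R.

Lemma size_descent_flags_nil (M : marks I) U : size (descent_flags [::] M U) = #|[pred q : M | mok q set0]|.
Proof.
rewrite /descent_flags size_filter /= count_map (eq_count (a2 := predT)) // count_predT.
by rewrite cardE enumT; congr size; apply: eq_filter => q; rewrite /= inE.
Qed.

Lemma card_layer_unit (rho : I -> nat) (rho_inj : injective rho) U k :
  #|layer (unit_marks rho_inj) U k| = 'C(#|U|, k).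
Proof.
rewrite -cards_draws -(card_imset _ (f := fun A : {set I} => (tt, A))) => [|A B []//].
apply: eq_card => -[[] A]; rewrite inE andbT; apply/andP/imsetP => [[sU cA] | [B]].
  by exists A; rewrite // inE sU.
by rewrite inE => /andP[sU cB] [->].
Qed.

Lemma size_descent_flags_unit ks U (rho : I -> nat) (rho_inj : injective rho) :
  path gtn #|U|.+1 ks -> (size (descent_flags ks (unit_marks rho_inj) U))%:Z%R = unmarked_count #|U| ks.
Proof.
elim: ks U rho rho_inj => [|k ks IH] U rho rho_inj pk.
  by rewrite size_descent_flags_nil card_unit.
have := size_descent_flags_cons (unit_marks rho_inj) pk.
move: pk => /= /andP[lek pk].
have low : path gtn #|U|.+1 ks by apply: path_gtn_weak pk; apply: ltnW.
move/(congr1 Posz); rewrite PoszD (IH U) // => /(canRL (addrK _)) ->; congr (_ - _)%R.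
rewrite (big_morph Posz PoszD (erefl _)) (eq_bigr (fun=> unmarked_count k ks)) => [|p].
  by rewrite sumr_const card_layer_unit -mulr_natl natz.
rewrite inE => /and3P[_ /eqP cp _]; rewrite -cp -(IH p.2 _ (@mrho_inj I (unit_marks rho_inj) p.1)) //.
by rewrite cp; apply: path_gtn_weak pk.
Qed.

Lemma size_descent_flags_marks (M : marks I) ks U :
  size (descent_flags [::] M U) = 1 -> (forall k, #|layer M U k| = k.+1 * 'C(#|U|, k)) ->
  path gtn #|U|.+1 ks -> (size (descent_flags ks M U))%:Z%R = marked_count #|U| ks.
Proof.
move=> base cl; elim: ks => [|k ks IH] pk; first by rewrite base.
have := size_descent_flags_cons M pk; move: pk => /= /andP[lek pk].
have low : path gtn #|U|.+1 ks by apply: path_gtn_weak pk; apply: ltnW.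
move/(congr1 Posz); rewrite PoszD IH // => /(canRL (addrK _)) ->; congr (_ - _)%R.
rewrite (big_morph Posz PoszD (erefl _)) (eq_bigr (fun=> unmarked_count k ks)) => [|p].
  by rewrite sumr_const cl -mulr_natl natz.
rewrite inE => /and3P[_ /eqP cp _]; rewrite -cp size_descent_flags_unit // cp.
exact: path_gtn_weak pk.
Qed.

(** Induction on [ks]: comparing the coefficients of [unmarked_count k ks] leaves N C(N-1, k) + k
    C(N, k) = N C(N, k). *)
Lemma marked_countE N ks : 0 < N -> (marked_count N ks = N.+1%:Z * unmarked_count N ks - N%:Z * unmarked_count N.-1 ks)%R.
Proof.
case: N => // N _; elim: ks => [|k ks IH] /=; first by lia.
rewrite {}IH; have : N.+1 * 'C(N, k) + k * 'C(N.+1, k) = N.+1 * 'C(N.+1, k).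
  have [lek | ltk] := leqP k N.+1; last by rewrite (bin_small ltk) (bin_small (ltnW ltk)) !muln0.
  by rewrite (mul_bin_down N.+1) -mulnDl subnK.
move/(congr1 (fun j => Posz j * unmarked_count k ks)%R); rewrite !PoszD !PoszM !intS [N.+1.-1]/=.
move: (unmarked_count k ks) (unmarked_count _ _) (unmarked_count _ _) => x y z; move: (Posz N) (Posz k) (Posz 'C(_, _)) => n k' a.
move: (Posz 'C(_, _)) => b'; nia.
Qed.

(** The only set of size [N] is the whole set, which leaves no room for a descent. *)
Lemma unmarked_count_full N ks : unmarked_count N (N :: ks) = 0%R.
Proof. by rewrite /= binn mul1r subrr. Qed.

(** No flag is counted here, but the recursion still has a value; the case arises when
    [marked_countE] lowers [N]. *)
Lemma unmarked_count_over N ks : unmarked_count N (N.+1 :: ks) = (- unmarked_count N ks)%R.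
Proof. by rewrite /= bin_small // mul0r sub0r. Qed.

(** * Monotonicity and positivity of the counts *)

Lemma descent_subr (rho : I -> nat) B A U' U : U' \subset U -> descent rho B A U' -> descent rho B A U.
Proof.
move=> sU /exists_inP[a aD /exists_inP[b /setDP[bU bA] lt]].
apply/exists_inP; exists a => //; apply/exists_inP; exists b => //.
by rewrite inE bA (subsetP sU).
Qed.

(** Only the condition on the first member involves [U], and it is monotone in [U]. *)
Lemma size_descent_flags_mono ks (M : marks I) U' U : U' \subset U -> size (descent_flags ks M U') <= size (descent_flags ks M U).
Proof.
move=> sU; apply: uniq_leq_size => [|[q l]]; first by rewrite filter_uniq ?flags_uniq.
rewrite !mem_filter !mem_flags /= => /andP[dl /and3P[-> -> pl]] /=.
case: l dl pl => //= A l /andP[dA ->] /andP[sA ->]; rewrite (subset_trans sA) // !andbT.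
by case/orP: dA => [-> // | /(descent_subr sU) ->]; rewrite orbT.
Qed.

Lemma descent_flags_unit_neq0 ks U (rho : I -> nat) (rho_inj : injective rho) :
  path gtn #|U| ks -> 0 \notin ks -> exists x, x \in descent_flags ks (unit_marks rho_inj) U.
Proof.
elim: ks U rho rho_inj => [|k ks IH] U rho rho_inj.
  by exists (tt, [::]); rewrite mem_filter mem_flags.
rewrite /= inE negb_or => /andP[ltk pk] /andP[k0 ks0].
(* [C] consists of the least [#|U| - k] elements of [U]; the first member is its complement [A], all
   of whose elements lie above those of [C]. *)
have [|C [_ sC cC nd]] := @min_extension _ rho set0 U (#|U| - k) (sub0set U).
  by rewrite cards0 leq_subr.
pose A := U :\: C.
have cA : #|A| = k by rewrite cardsDS // cC subKn // ltnW.
have [|[[] l] lD] := IH A rho rho_inj _ ks0; first by rewrite cA.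
exists (tt, A :: l); move: lD; rewrite !mem_filter.
rewrite (mem_flags _ (M := unit_marks rho_inj) _ (tt, l)).
rewrite (mem_flags _ (M := unit_marks rho_inj) _ (tt, A :: l)) /= => /and3P[dl /eqP cl pl].
rewrite (_ : all_descents _ _ _ = true); last by rewrite -dl; congr all_descents.
rewrite cA cl eqxx pl subsetDl /= !andbT.
have sh : hd l \subset A by case: (l) pl => [|B l'] /=; rewrite ?sub0set // => /andP[].
have /card_gt0P[a aD] : 0 < #|A :\: hd l|.
  rewrite cardsDS // subn_gt0 cA; move: cl pk ks0.
  case: (l) => [|B l'] /=; first by rewrite cards0 lt0n eq_sym.
  by case: (ks) => //= k1 ks1 [-> _] /andP[].
have /card_gt0P[b bD] : 0 < #|U :\: A| by rewrite cardsDS ?subsetDl // cA subn_gt0.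
apply/exists_inP; exists a => //; apply/exists_inP; exists b => //.
move: aD bD; rewrite !inE => /and3P[_ aC aU] /andP[]; rewrite negb_and negbK => bC bU.
have {}bC : b \in C by case/orP: bC => //; rewrite bU.
rewrite ltn_neqAle (descentPn _ _ _ _ nd) ?inE // andbT.
by apply: contra aC => /eqP/rho_inj <-.
Qed.

End Counting.

Lemma unmarked_count_gt0 N ks : path gtn N ks -> 0 \notin ks -> (0 < unmarked_count N ks)%R.
Proof.
move=> pk k0; have pk' : path gtn #|[set: 'I_N]| ks by rewrite cardsT card_ord.
have [x xD] := descent_flags_unit_neq0 (@ord_inj N) pk' k0.
have := size_descent_flags_unit (U := [set: 'I_N]) (@ord_inj N) (path_gtn_weak (leqnSn _) pk').
rewrite cardsT card_ord => <-; rewrite ltz_nat.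
by case: (descent_flags _ _ _) xD.
Qed.

(** Both counts are realized inside ['I_N], the smaller one on the complement of one element. *)
Lemma unmarked_count_mono N ks : path gtn N ks -> (unmarked_count N.-1 ks <= unmarked_count N ks)%R.
Proof.
case: N => [|N] pk //=; pose U := [set~ @ord0 N].
have cU : #|U| = N by rewrite cardsC1 card_ord.
have cT : #|[set: 'I_N.+1]| = N.+1 by rewrite cardsT card_ord.
have := size_descent_flags_unit (U := U) (@ord_inj _) (ks := ks); rewrite cU => <- //.
have := size_descent_flags_unit (U := [set: 'I_N.+1]) (@ord_inj _) (ks := ks); rewrite cT => <- //.
  by rewrite lez_nat size_descent_flags_mono ?subsetT.
by apply: path_gtn_weak pk.
Qed.

(** * Marks for the stabilizer of the last element *)

Section FloorMarks.

Variable n : nat.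
Implicit Types (A B : {set 'I_n.+1}) (p q : 'I_n.+1).

Definition floor B q : 'I_n.+1 := [arg max_(p > ord0 | (p \in ord0 |: B) && (p <= q)) p].

Lemma floorP B q : [/\ floor B q \in ord0 |: B, floor B q <= q &
  forall p, p \in ord0 |: B -> p <= q -> p <= floor B q].
Proof.
rewrite /floor; case: arg_maxnP => [|p /andP[pB lep] max_p]; first by rewrite setU11.
by split=> // p' p'B lep'; apply: max_p; rewrite p'B.
Qed.

Lemma floor_unique B q p : p \in ord0 |: B -> p <= q ->
  (forall p', p' \in ord0 |: B -> p' <= q -> p' <= p) -> floor B q = p.
Proof.
move=> pB lep max_p; have [fB lef maxf] := floorP B q.
by apply/val_inj/eqP; rewrite eqn_leq max_p // maxf.
Qed.

Lemma floor_id B q : q \in ord0 |: B -> floor B q = q.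
Proof. by move=> qB; apply: floor_unique. Qed.

Lemma floor_comp A B q : B \subset A -> floor B (floor A q) = floor B q.
Proof.
move=> sBA; have [fB lef maxf] := floorP B q; have [fA leA maxA] := floorP A q.
apply: floor_unique => // [|p pB lep]; last by rewrite maxf // (leq_trans lep).
by rewrite maxA // (subsetP (setUS _ sBA)).
Qed.

(* The cyclic order of the positions in which q comes last. *)
Definition rotation q (p : 'I_n.+1) : nat := (p + (n - q)) %% n.+1.

Lemma rotation_last q : rotation q q = n.
Proof. by rewrite /rotation subnKC ?modn_small // -ltnS. Qed.

Lemma rotation_inj q : injective (rotation q).
Proof.
move=> p p' /eqP; rewrite /rotation eqn_modDr !modn_small // => /eqP/val_inj.
by [].
Qed.

(** The mark stands for the value of a ranking function at the last element, which coarsening lowers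
    by [floor]. Rotating the order puts [q] last, so [mrho_top] holds with [q] itself as the lost
    element. *)
Program Definition floor_marks : marks 'I_n.+1 :=
  @Marks _ 'I_n.+1 (@nat_of_ord _) (fun q A => q \in ord0 |: A) floor rotation _ _ _ _ _ rotation_inj _.
Next Obligation. by have [] := floorP B q. Qed.
Next Obligation. exact: floor_id. Qed.
Next Obligation.
have [fB lef _] := floorP B q; rewrite ltn_neqAle lef andbT.
by apply: contra H => /eqP/val_inj <-.
Qed.
Next Obligation. exact: floor_comp. Qed.
Next Obligation. by move: H0; apply/subsetP/setUS. Qed.
Next Obligation.
exists q => [|b]; last by rewrite rotation_last -ltnS ltn_mod.
by move: H0 H1; rewrite !inE negb_or => /orP[/eqP-> | ->]; rewrite ?eqxx // => /andP[_ ->].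
Qed.

Definition positions : {set 'I_n.+1} := [set~ ord0].

Lemma card_positions : #|positions| = n.
Proof. by rewrite cardsC1 card_ord. Qed.

Lemma size_descent_flags_floor ks : path gtn n.+1 ks ->
  (size (descent_flags ks floor_marks positions))%:Z%R = marked_count n ks.
Proof.
move=> pk; rewrite -[n in RHS]card_positions; apply: size_descent_flags_marks; rewrite ?card_positions //.
  by rewrite size_descent_flags_nil (eq_card (B := pred1 ord0)) ?card1 // => q; rewrite !inE orbF.
move=> k; pose S := [set A : {set 'I_n.+1} | A \subset positions & #|A| == k].
transitivity (\sum_(A in S) \sum_(q in ord0 |: A) 1).
  rewrite pair_big_dep /= sum1_card.
  rewrite -(card_imset _ (f := fun p : {set 'I_n.+1} * 'I_n.+1 => (p.2, p.1))) => [|[A q] [A' q'] [-> ->] //].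
  apply: eq_card => -[q A]; rewrite inE /= andbA; apply/idP/imsetP => [qA | [[A' q'] + [-> ->]]].
    by exists (A, q) => //; case/andP: qA => sA okA; apply/andP; split; first rewrite inE.
  by case/andP; rewrite /= inE => ->.
rewrite (eq_bigr (fun=> k.+1)) => [|A].
  by rewrite sum_nat_const cards_draws card_positions mulnC.
rewrite inE => /andP[sA /eqP cA]; rewrite sum1_card cardsU1 cA.
by case: (boolP (ord0 \in A)) => // /(subsetP sA); rewrite !inE eqxx.
Qed.

End FloorMarks.

(** * Ordered set partitions as ranking functions *)

Lemma card_imset_ker (T R S : finType) (f : T -> R) (g : T -> S) :
  (forall a b, (f a == f b) = (g a == g b)) -> #|[set f a | a in T]| = #|[set g a | a in T]|.
Proof.
move=> E; pose h a := (f a, g a).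
have -> : [set f a | a in T] = [set p.1 | p in [set h a | a in T]] by rewrite -imset_comp.
have -> : [set g a | a in T] = [set p.2 | p in [set h a | a in T]] by rewrite -imset_comp.
rewrite (card_in_imset (f := fst)) ?(card_in_imset (f := snd)) //;
  move=> _ _ /imsetP[a _ ->] /imsetP[b _ ->] /= /eqP.
  by rewrite -E => /eqP e; rewrite /h e; congr pair; apply/eqP; rewrite -E e.
by rewrite E => /eqP e; rewrite /h e; congr pair; apply/eqP; rewrite E e.
Qed.

Section Levels.

Variable n : nat.
Local Notation T := 'I_n.+1.
Implicit Types (x y z : osp n.+1) (a b c : T).

Definition level x a : nat := find (fun B : {set T} => a \in B) (blocks x).

Lemma has_blocks x a : has (fun B : {set T} => a \in B) (blocks x).
Proof.
have /and3P[_ _ /eqP/setP/(_ a)] := valP x; rewrite inE.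
by rewrite bigcup_seq => /bigcupP[B Bx aB]; apply/hasP; exists B.
Qed.

Lemma level_lt x a : level x a < size (blocks x).
Proof. by rewrite -has_find has_blocks. Qed.

Lemma mem_level x a : a \in nth set0 (blocks x) (level x a).
Proof. exact: nth_find (has_blocks x a). Qed.

Lemma nth_blocks x i : i < size (blocks x) -> nth set0 (blocks x) i = [set a | level x a == i].
Proof.
move=> lti; have /and3P[_ /(pairwiseP set0) dis _] := valP x.
apply/setP=> a; rewrite inE; apply/idP/eqP => [ai | <-]; last exact: mem_level.
case: (ltngtP (level x a) i) => // lt; have la := mem_level x a.
  by have /disjoint_setI0/setP/(_ a) := dis _ _ (level_lt x a) lti lt; rewrite !inE la ai.
by have /disjoint_setI0/setP/(_ a) := dis _ _ lti (level_lt x a) lt; rewrite !inE la ai.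
Qed.

Lemma level_surj x i : i < size (blocks x) -> exists a, level x a = i.
Proof.
move=> lti; have /and3P[x0 _ _] := valP x.
have : nth set0 (blocks x) i != set0 by apply: contraNneq x0 => <-; apply: mem_nth.
by case/set0Pn=> a; rewrite nth_blocks // inE => /eqP; exists a.
Qed.

Lemma level_inj x y : level x =1 level y -> x = y.
Proof.
have le_size u v : level u =1 level v -> size (blocks u) <= size (blocks v).
  move=> E; rewrite leqNgt; apply/negP => /level_surj[a ea].
  by have := level_lt v a; rewrite -E ea ltnn.
move=> E; have eq_size : size (blocks x) = size (blocks y).
  by apply/eqP; rewrite eqn_leq !le_size.
apply: blocks_inj; apply: (@eq_from_nth _ set0) => // i lti.
by rewrite !nth_blocks -?eq_size //; apply/setP=> a; rewrite !inE E.
Qed.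

(* The levels form an initial segment of nat, so they are determined by their order. *)
Lemma level_order_inj x y : (forall a b, (level x a <= level x b) = (level y a <= level y b)) -> x = y.
Proof.
move=> E; apply: level_inj => a; move: {2}(level x a) (erefl (level x a)) => k.
have {}E b c : (level x b < level x c) = (level y b < level y c) by rewrite !ltnNge E.
elim/ltn_ind: k a => k IH a eka; rewrite eka.
have IH' b : level x b < k -> level y b = level x b by move=> lt; rewrite (IH _ lt b).
case: (ltngtP k (level y a)) => // lt.
  have [c ec] := level_surj (ltn_trans lt (level_lt y a)).
  by have := lt; rewrite -{1}ec -E eka => /IH'; rewrite ec => /esym; have := E c a; rewrite ec lt eka => + e; rewrite e ltnn.
have [b eb] := level_surj (ltn_trans lt (leq_ltn_trans (eq_leq (esym eka)) (level_lt x a))).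
by have := E b a; rewrite IH' eb ?eka ?lt ?ltnn.
Qed.

Definition start_set x a : {set T} := [set b | level x b < level x a].

Lemma start_subproof x a : #|start_set x a| < n.+1.
Proof.
rewrite -[X in _ < X]card_ord -cardsT; apply: proper_card; rewrite properT.
by apply/eqP=> /setP/(_ a); rewrite !inE ltnn.
Qed.

Definition start x a : T := locked (Ordinal (start_subproof x a)).

Lemma startE x a : start x a = #|start_set x a| :> nat.
Proof. by rewrite /start -lock. Qed.

Lemma start_leq x a b : (start x a <= start x b) = (level x a <= level x b).
Proof.
rewrite !startE; apply/idP/idP => [|le]; last first.
  by apply: subset_leq_card; apply/subsetP=> c; rewrite !inE => /leq_trans->.
rewrite leqNgt => nlt; rewrite leqNgt; apply: contra nlt => lt; apply: proper_card.
apply/properP; split; first by apply/subsetP=> c; rewrite !inE => /ltn_trans->.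
by exists b; rewrite !inE ?ltnn.
Qed.

Lemma start_ltn x a b : (start x a < start x b) = (level x a < level x b).
Proof. by rewrite !ltnNge start_leq. Qed.

Lemma start_inj x y : start x =1 start y -> x = y.
Proof. by move=> E; apply: level_order_inj => a b; rewrite -!start_leq !E. Qed.

(** The value 0 is always attained and is left out, so that the cardinal is the number of blocks
    minus one, which is the corank ([crk_key]). *)
Definition starts x : {set T} := [set start x a | a in T] :\ ord0.

Lemma start0_ex x : exists a, start x a = ord0.
Proof.
have [a ea] := level_surj (leq_ltn_trans (leq0n _) (level_lt x ord0)).
exists a; apply/ord_inj/eqP; rewrite startE cards_eq0; apply/eqP/setP=> b.
by rewrite !inE ea ltn0.
Qed.

Lemma startsU0 x : ord0 |: starts x = [set start x a | a in T].
Proof.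
by rewrite setD1K //; have [a <-] := start0_ex x; apply: imset_f.
Qed.

Lemma card_starts x : (#|starts x|).+1 = size (blocks x).
Proof.
have := cardsU1 ord0 (starts x); rewrite in_setD1 eqxx /= add1n => <-; rewrite startsU0.
pose f a : 'I_(size (blocks x)) := Ordinal (level_lt x a).
rewrite -[RHS]card_ord -cardsT (@card_imset_ker _ _ _ _ f) => [|a b]; last first.
  by rewrite -!val_eqE /= 2!eqn_leq !start_leq.
congr #|pred_of_set _|; apply/setP=> i; rewrite inE.
by have [a ea] := level_surj (ltn_ord i); apply/imsetP; exists a => //; apply: val_inj.
Qed.

End Levels.

(** * Coarsening in terms of ranking functions *)

Section OspOf.

Variable n : nat.
Local Notation T := 'I_n.+1.
Implicit Types (x y z : osp n.+1) (a b c : T) (S : {set T}).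

Section Def.

Variable h : T -> nat.

Definition values := sort leq (undup (codom h)).

Lemma mem_values a : h a \in values.
Proof. by rewrite mem_sort mem_undup codom_f. Qed.

Lemma size_osp_of : size [seq [set a | h a == v] | v <- values] <= n.+1.
Proof.
rewrite size_map size_sort (leq_trans (size_undup _)) // size_codom card_ord.
exact: leqnn.
Qed.

Lemma values_sorted : sorted ltn values.
Proof. by rewrite ltn_sorted_uniq_leq sort_uniq undup_uniq sort_sorted //; apply: leq_total. Qed.

Lemma osp_of_subproof : is_osp (Bseq size_osp_of).
Proof.
apply/and3P; split=> /=.
- apply/mapP=> -[v]; rewrite mem_sort mem_undup => /codomP[a ->] /setP/(_ a).
  by rewrite !inE eqxx.
- have := values_sorted; rewrite (sorted_pairwise ltn_trans) pairwise_map.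
  apply: sub_pairwise => u v /= lt; rewrite disjoint_subset; apply/subsetP=> a.
  by rewrite !inE => /eqP ->; rewrite neq_ltn lt.
apply/eqP/setP=> a; rewrite inE bigcup_seq; apply/bigcupP.
exists [set b | h b == h a]; last by rewrite inE.
by apply: (map_f (fun v => [set b | h b == v])); apply: mem_values.
Qed.

Definition osp_of : osp n.+1 :=
  exist (fun t : n.+1.-bseq {set T} => is_osp t) _ osp_of_subproof.

Lemma level_osp_of a : level osp_of a = index (h a) values.
Proof.
rewrite /level /blocks /= find_map; apply: eq_find => v /=.
by rewrite inE eq_sym.
Qed.

Lemma level_osp_of_leq a b : (level osp_of a <= level osp_of b) = (h a <= h b).
Proof.
have lt_lev c d : level osp_of c < level osp_of d -> h c < h d.
  by rewrite !level_osp_of; apply: (sorted_ltn_index ltn_trans values_sorted); apply: mem_values.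
apply/idP/idP => le; rewrite leqNgt; last first.
  by apply/negP=> /lt_lev; rewrite ltnNge le.
apply/negP => lt; have := le; rewrite leq_eqVlt => /orP[/eqP|/lt_lev lt']; last first.
  by have := ltn_trans lt lt'; rewrite ltnn.
rewrite !level_osp_of => /(index_inj 0 (mem_values a) (mem_values b)) e.
by rewrite e ltnn in lt.
Qed.

Lemma start_osp_of a : start osp_of a = #|[set b | h b < h a]| :> nat.
Proof.
by rewrite startE; apply: eq_card => b; rewrite !inE !ltnNge level_osp_of_leq.
Qed.

Lemma level_osp_of_id k : (forall a, h a < k) -> (forall i, i < k -> exists a, h a = i) ->
  level osp_of =1 h /\ size (blocks osp_of) = k.
Proof.
move=> lth surj; have eV : values = iota 0 k.
  apply: (irr_sorted_eq ltn_trans ltnn values_sorted (iota_ltn_sorted 0 k)) => v.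
  rewrite mem_sort mem_undup mem_iota /= add0n; apply/codomP/idP => [[a ->] // | /surj[a <-]].
  by exists a.
split=> [a|]; last by rewrite size_map eV size_iota.
rewrite level_osp_of eV -[X in index X](nth_iota 0 0 (lth a)) index_uniq ?iota_uniq //.
by rewrite size_iota.
Qed.

End Def.

Definition level_le x y := forall a b, level x a <= level x b -> level y a <= level y b.

(** The new level of an element of level [j] when blocks [i] and [i.+1], counted from 0, are
    merged. *)
Definition collapse (i j : nat) := if j <= i then j else j.-1.

Lemma collapse_mono i j k : j <= k -> collapse i j <= collapse i k.
Proof. by rewrite /collapse; case: ifP; case: ifP; lia. Qed.

Lemma nth_merge_at x i j : i.+1 < size (blocks x) -> j.+1 < size (blocks x) ->
  nth set0 (merge_at i (blocks x)) j = [set a | collapse i (level x a) == j].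
Proof.
move=> lti ltj; rewrite /merge_at nth_cat size_takel; last by rewrite ltnW // ltnW.
have [ltji | leij] := ltnP j i.
  rewrite nth_take // nth_blocks ?(ltnW ltj) //; apply/setP=> a; rewrite !inE /collapse.
  by case: ifP; lia.
case: (posnP (j - i)) => [e | pos].
  have {leij e} -> : j = i by lia.
  rewrite subnn /= !nth_blocks // ?(ltnW lti) //; apply/setP=> a; rewrite !inE /collapse.
  by case: ifP; lia.
rewrite -[j - i]prednK //= nth_drop.
have -> : i.+2 + (j - i).-1 = j.+1 by lia.
rewrite nth_blocks //; apply/setP=> a; rewrite !inE /collapse.
by case: ifP; lia.
Qed.

Lemma merge_rel_level x z i : i.+1 < size (blocks x) -> blocks z = merge_at i (blocks x) ->
  level z =1 collapse i \o level x.
Proof.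
move=> lti ez a /=; have sz := size_merge_at lti.
have ltc : (collapse i (level x a)).+1 < size (blocks x).
  by rewrite /collapse; have := level_lt x a; case: ifP; lia.
have : a \in nth set0 (blocks z) (collapse i (level x a)).
  by rewrite ez nth_merge_at // inE.
rewrite nth_blocks; last by rewrite ez -ltnS sz.
by rewrite inE => /eqP.
Qed.

Lemma merge_exists x i : i.+1 < size (blocks x) ->
  exists2 z, merge_rel x z & level z =1 collapse i \o level x.
Proof.
move=> lti; have sz := size_merge_at lti; pose h := collapse i \o level x.
have [||eh es] := @level_osp_of_id h (size (blocks x)).-1.
- by move=> a; rewrite /h /= /collapse; have := level_lt x a; case: ifP; lia.
- move=> j ltj; pose j' := if j <= i then j else j.+1.
  have [|a ea] := @level_surj _ x j'; first by rewrite /j'; case: ifP; lia.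
  by exists a; rewrite /h /= ea /collapse /j'; case: (leqP j i); case: ifP; lia.
exists (osp_of h) => //; have lein : i < n.+1.
  by have := card_starts x; have := max_card (starts x); rewrite card_ord; lia.
apply/existsP; exists (Ordinal lein); rewrite lti /=; apply/eqP.
apply: (@eq_from_nth _ set0) => [|j]; first by rewrite es -sz.
rewrite es => ltj; rewrite nth_blocks ?es // nth_merge_at //; last by lia.
by apply/setP=> a; rewrite !inE eh.
Qed.

(** Chains of merges become a comparison of weak orders. For the converse, adjacent blocks of [x]
    are merged by induction on their number. *)
Lemma osp_leP x y : osp_le x y <-> level_le x y.
Proof.
split=> [/connectP[p + ->] {y} | ].
  elim: p x => [|z p IH] x /=; first by move=> _ a b.
  case/andP=> /existsP[i /andP[lti /eqP ez]] /IH le_z a b le; apply: le_z.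
  by rewrite !(merge_rel_level lti ez) /=; apply: collapse_mono.
move: {2}(size _) (leqnn (size (blocks x))) => m.
elim: m x => [|m IH] x lem le_xy; first by have := level_lt x ord0; lia.
have [inv | ] := boolP [forall a, forall b, (level y a <= level y b) ==> (level x a <= level x b)].
  suff -> : x = y by apply: osp_le_refl.
  apply: level_order_inj => a b; apply/idP/idP; first exact: le_xy.
  by move/forallP/(_ a)/forallP/(_ b)/implyP: inv.
(* [x] puts [a] strictly before [b] and [y] does not, so [y] is constant on the blocks of [x] from
   that of [a] to that of [b]; the first two of these are merged. *)
rewrite negb_forall => /existsP[b]; rewrite negb_forall => /existsP[a].
rewrite negb_imply -ltnNge => /andP[le_ba lt_ab].
have lti : (level x a).+1 < size (blocks x) by apply: leq_ltn_trans lt_ab (level_lt x b).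
have [z xz ez] := merge_exists lti; have [c ec] := level_surj lti.
have lev_y d : level x a <= level x d <= (level x a).+1 -> level y d = level y a.
  case/andP=> le1 le2; apply/eqP; rewrite eqn_leq (le_xy _ _ le1) andbT.
  by apply: leq_trans le_ba; apply: le_xy; apply: leq_trans le2 lt_ab.
apply: connect_trans (connect1 xz) _; apply: IH => [|d e].
  case/existsP: xz => i /andP[lt_i /eqP ->].
  by have := size_merge_at lt_i; lia.
rewrite !ez /=; have [le _ | lt] := leqP (level x d) (level x e); first exact: le_xy.
rewrite /collapse; case: ifP; case: ifP => H1 H2 H3; try by lia.
by rewrite (lev_y d) ?(lev_y e) //; lia.
Qed.

(** Passing to [y] can only lower a start. If [c] comes after [a] in [y], so it does after
    everything in [x] up to and including the block of [a]; hence its start in [y] exceeds that of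
    [a] in [x]. *)
Lemma le_start x y : osp_le x y -> start y =1 floor (starts y) \o start x.
Proof.
move/osp_leP => le a /=; apply/esym; apply: floor_unique.
- by rewrite startsU0 imset_f.
- rewrite !startE; apply: subset_leq_card; apply/subsetP=> b; rewrite !inE !ltnNge.
  by apply: contra; apply: le.
move=> p; rewrite startsU0 => /imsetP[c _ ->]; apply: contraTT.
rewrite -!ltnNge => lt; rewrite !startE; apply: proper_card; apply/properP; split.
  apply/subsetP=> b; rewrite !inE => ltb; move: lt; rewrite start_ltn => lt.
  by apply: leq_ltn_trans lt; apply: le; apply: ltnW.
by exists a; rewrite !inE ?ltnn // -start_ltn.
Qed.

(* Among the elements with a given level in y, one of lowest level in x has the same start in x and y. *)
Lemma le_starts x y : osp_le x y -> starts y \subset starts x.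
Proof.
move=> /osp_leP le; apply/subsetP=> p /setD1P[p0 /imsetP[a _ ep]].
apply/setD1P; split=> //; apply/imsetP.
have [c /eqP lec min_c] := @arg_minnP _ a (fun c => level y c == level y a) (level x) (eqxx _).
exists c => //; rewrite ep; apply/ord_inj; rewrite !startE; apply: eq_card => b; rewrite !inE -lec.
apply/idP/idP => [|lt]; first by rewrite !ltnNge; apply: contra; apply: le.
rewrite ltn_neqAle (le _ _ (ltnW lt)) andbT; apply/negP => e.
by have := min_c b; rewrite -lec e leqNgt lt => /(_ isT).
Qed.

Lemma le_start_inj x y y' : osp_le x y -> osp_le x y' -> starts y = starts y' -> y = y'.
Proof. by move=> le le' e; apply: start_inj => a; rewrite (le_start le) (le_start le') /= e. Qed.

Lemma start_floor_osp S x : S \subset starts x ->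
  start (osp_of (fun a => floor S (start x a))) =1 floor S \o start x.
Proof.
move=> sS a; apply: ord_inj; rewrite start_osp_of.
have [fS lef maxf] := floorP S (start x a).
have /imsetP[c _ ec] : floor S (start x a) \in [set start x a | a in T].
  by rewrite -startsU0 (subsetP (setUS _ sS)).
rewrite /= ec [RHS]startE; apply: eq_card => b; rewrite !inE -start_ltn -ec.
have [fSb lefb maxb] := floorP S (start x b).
apply/idP/idP; last exact: leq_ltn_trans lefb.
by rewrite !ltnNge; apply: contra; apply: maxb.
Qed.

Lemma starts_floor x y S : S \subset starts x -> start y =1 floor S \o start x -> starts y = S.
Proof.
move=> sS ey; apply/setP=> p; rewrite in_setD1; apply/andP/idP => [[p0 /imsetP[a _ ep]] | pS].
  have [fS _ _] := floorP S (start x a); move: fS p0; rewrite ep ey /= !inE.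
  by case/orP => [-> | ].
have := subsetP sS _ pS; rewrite in_setD1 => /andP[p0 /imsetP[a _ ep]]; split=> //.
by apply/imsetP; exists a; rewrite // ey /= -ep floor_id // inE pS orbT.
Qed.

Lemma floor_mono S (p q : T) : p <= q -> floor S p <= floor S q.
Proof.
move=> le; have [fS lef _] := floorP S p; have [_ _ maxf] := floorP S q.
by apply: maxf => //; apply: leq_trans le.
Qed.

Lemma le_of_floor x y S : start y =1 floor S \o start x -> osp_le x y.
Proof.
move=> ey; apply/osp_leP => a b; rewrite -!start_leq !ey => le; apply: floor_mono; apply: le.
Qed.

(** With [le_starts], [le_start_inj] and [le_starts_le], the elements above [x] are identified with
    the subsets of [starts x] under reverse inclusion. *)
Lemma coarsen_ex S x : S \subset starts x -> exists2 y, osp_le x y & starts y = S.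
Proof.
move=> sS; have e := start_floor_osp sS; exists (osp_of (fun a => floor S (start x a))).
  exact: le_of_floor e.
exact: starts_floor e.
Qed.

Lemma le_starts_le x y y' : osp_le x y -> osp_le x y' -> starts y' \subset starts y -> osp_le y y'.
Proof.
move=> le le' sS; apply: (@le_of_floor y y' (starts y')) => a.
by rewrite (le_start le') /= (le_start le) /= floor_comp.
Qed.

Definition osp_fine : osp n.+1 := osp_of (fun a => a).

Lemma start_fine a : start osp_fine a = a.
Proof.
apply: ord_inj; rewrite start_osp_of -sum1dep_card.
by rewrite -(big_ord_widen n.+1 (fun=> 1)) ?sum1_card ?card_ord // ltnW.
Qed.

Lemma starts_fine : starts osp_fine = positions n.
Proof.
apply/setP=> p; rewrite in_setD1 !inE; case: eqP => //= _; apply/imsetP.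
by exists p; rewrite ?start_fine.
Qed.

Lemma starts_sub x : starts x \subset positions n.
Proof. by apply/subsetP=> p; rewrite !inE => /andP[]. Qed.

Lemma starts_ex S : S \subset positions n -> exists x, starts x = S.
Proof.
by move=> sS; have [|x _ <-] := @coarsen_ex S osp_fine; rewrite ?starts_fine //; exists x.
Qed.

Lemma fine_below x : exists y, [/\ osp_le y x, injective (start y) & starts y = positions n].
Proof.
(* [h] orders by level in [x] and breaks ties by the element itself, which splits each block into
   singletons. *)
pose h a := level x a * n.+1 + a; pose y := osp_of h.
have le_yx : osp_le y x.
  apply/osp_leP=> a b; rewrite level_osp_of_leq /h; apply: contraTT; rewrite -!ltnNge => lt.
  apply: (@leq_trans ((level x b).+1 * n.+1)).
    by rewrite mulSn addnC ltn_add2r.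
  by rewrite (leq_trans _ (leq_addr _ _)) // leq_mul2r lt orbT.
have h_inj : injective h.
  move=> a b e; apply/val_inj; have := congr1 (modn^~ n.+1) e.
  by rewrite /h !modnMDl !modn_small.
have st_inj' : injective (start y).
  have le_h a b : (h a <= h b) = (start y a <= start y b) by rewrite start_leq level_osp_of_leq.
  by move=> a b e; apply: h_inj; apply/eqP; rewrite eqn_leq !le_h e leqnn.
exists y; split=> //; apply/eqP; rewrite eqEcard starts_sub card_positions.
have := cardsU1 ord0 (starts y); rewrite in_setD1 eqxx /= startsU0 card_imset // card_ord add1n.
by case=> <-.
Qed.

(** * Orbits of ordered set partitions *)

Lemma start_act x (s : 'S_n.+1) a : start (osp_act x s) (s a) = start x a.
Proof.
have elev b : level (osp_act x s) (s b) = level x b.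
  rewrite /level blocks_act find_map; apply: eq_find => B /=.
  by rewrite mem_imset //; apply: perm_inj.
apply: ord_inj; rewrite !startE /start_set -[RHS](card_imset _ (@perm_inj _ s)); apply: eq_card => b.
apply/idP/imsetP => [|[c + ->]]; rewrite !inE elev.
  by move=> lt; exists (s^-1 b)%g; rewrite ?permKV // inE -(elev (s^-1 b)%g) permKV.
by rewrite elev.
Qed.

Lemma starts_act x (s : 'S_n.+1) : starts (osp_act x s) = starts x.
Proof.
congr (_ :\ _); apply/setP=> p; apply/imsetP/imsetP => -[a _ ->].
  by exists (s^-1 a)%g; rewrite // -(start_act x s) permKV.
by exists (s a); rewrite // start_act.
Qed.

Lemma sorting_perm x : exists g : 'S_n.+1, start x =1 floor (starts x) \o g.
Proof.
by have [y [le_yx y_inj _]] := fine_below x; exists (perm y_inj) => a; rewrite /= permE (le_start le_yx).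
Qed.

(** Both start functions are the same floor map after a permutation; one permutation followed by the
    inverse of the other moves [x] to [y]. *)
Lemma act_ex x y : starts x = starts y -> exists g : 'S_n.+1, osp_act x g = y.
Proof.
move=> e; have [g eg] := sorting_perm x; have [h eh] := sorting_perm y.
exists (g * h^-1)%g; apply: start_inj => a.
rewrite -[a](permKV (g * h^-1)%g) start_act eg /= eh /= e; congr floor.
by rewrite permM permKV.
Qed.

Lemma act_ex_fix x y : starts x = starts y -> start x ord_max = start y ord_max ->
  exists2 g : 'S_n.+1, g ord_max = ord_max & osp_act x g = y.
Proof.
(* [c] and [ord_max] lie in one block of [y], so their transposition fixes [y] and corrects [g]. *)
move=> e eq_max; have [g eg] := act_ex e; pose c := g ord_max.
have ec : start y c = start y ord_max by rewrite -eq_max -eg start_act.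
exists (g * tperm c ord_max)%g; first by rewrite permM tpermL.
rewrite osp_actM eg; apply: start_inj => a.
rewrite -[a in LHS](permKV (tperm c ord_max)) start_act tpermV.
by case: tpermP => // ->.
Qed.

Lemma starts_mark_ex S (q : T) : S \subset positions n -> q \in ord0 |: S ->
  exists2 x, starts x = S & start x ord_max = q.
Proof.
(* In this coarsening of the ordered singletons the element [q] starts at [q]; a transposition
   brings that value to [ord_max]. *)
move=> sS qS; have [|x le_x ex] := @coarsen_ex S osp_fine; first by rewrite starts_fine.
exists (osp_act x (tperm q ord_max)); first by rewrite starts_act.
by rewrite -[X in start _ X](tpermL q ord_max) start_act (le_start le_x) /= start_fine ex floor_id.
Qed.

End OspOf.

(** * Chains of ordered set partitions *)

Section Rank.

Variables (disp : Order.disp_t) (P : finPOrderType disp).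
Implicit Types (x y z : P) (c : {set P}).

Lemma is_chainP c : reflect {in c &, forall x y, (x >=< y)%O} (is_chain c).
Proof.
apply: (iffP forall_inP) => [H x y xc yc | H x xc]; first by have /forall_inP := H x xc; apply.
by apply/forall_inP=> y yc; apply: H.
Qed.

Lemma rk_lt z x : (z < x)%O -> rk z < rk x.
Proof.
move=> ltzx; have chainU c : is_chain c -> [forall y in c, (y < z)%O] -> #|c| < rk x.
  move=> /is_chainP ch /forall_inP ltc; have zc : z \notin c.
    by apply/negP => /ltc; rewrite ltxx.
  have -> : #|c|.+1 = #|z |: c| by rewrite cardsU1 zc.
  apply: leq_bigmax_cond; apply/andP; split; last first.
    by apply/forall_inP=> y /setU1P[-> // | /ltc lt]; apply: lt_trans ltzx.
  apply/is_chainP=> u v /setU1P[->|uc] /setU1P[->|vc]; rewrite ?comparablexx //.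
  - by rewrite comparable_sym (lt_comparable (ltc _ vc)).
  - by rewrite (lt_comparable (ltc _ uc)).
  exact: ch.
have rk_gt0 : 0 < rk x.
  rewrite -(cards0 P); apply: chainU; first by apply/is_chainP=> u v; rewrite inE.
  by apply/forall_inP=> u; rewrite inE.
rewrite -(prednK rk_gt0) ltnS; apply/bigmax_leqP=> c /andP[ch ltc].
by rewrite -ltnS prednK // chainU.
Qed.

(** A chain strictly below [x] has distinct keys, all above [key x] and at most [K]; conversely, one
    can step down with the key growing by one until it is [K]. *)
Lemma rk_key (key : P -> nat) K :
  {homo key : x y / (x < y)%O >-> y < x} -> (forall x, key x <= K) ->
  (forall x, key x < K -> exists2 z, (z < x)%O & key z = (key x).+1) ->
  forall x, rk x = K - key x.
Proof.
move=> key_lt leK ex x; apply/eqP; rewrite eqn_leq; apply/andP; split.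
  apply/bigmax_leqP=> c /andP[/is_chainP ch /forall_inP ltc].
  pose f y : 'I_K.+1 := inord (key y).
  have fE y : f y = key y :> nat by rewrite inordK // ltnS.
  have f_inj : {in c &, injective f}.
    move=> y z yc zc /(congr1 (@nat_of_ord _)); rewrite !fE => e.
    have := ch y z yc zc; rewrite /Order.comparable !le_eqVlt => /orP[|] /orP[/eqP // | /key_lt].
      by rewrite e ltnn.
    by rewrite e ltnn.
  rewrite -(card_in_imset f_inj).
  have -> : K - key x = #|[set i : 'I_K.+1 | key x < i]|.
    have := cardsC [set i : 'I_K.+1 | key x < i]; rewrite card_ord.
    have -> : ~: [set i : 'I_K.+1 | key x < i] = [set i : 'I_K.+1 | i < (key x).+1].
      by apply/setP=> i; rewrite !inE -leqNgt ltnS.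
    rewrite -[#|[set i : 'I_K.+1 | i < _]|]sum1dep_card -(big_ord_widen K.+1 (fun=> 1)) ?ltnS //.
    by rewrite sum1_card card_ord; have := leK x; lia.
  apply: subset_leq_card; apply/subsetP=> _ /imsetP[y yc ->]; rewrite inE fE.
  exact/key_lt/ltc.
move: {2}(K - key x) (leqnn (K - key x)) => m; elim: m x => [|m IH] x lem.
  by rewrite (leq_trans lem).
have [leKx | ltKx] := leqP K (key x); first by have -> : K - key x = 0 by lia.
have [z ltzx ez] := ex x ltKx; have := IH z; have := rk_lt ltzx.
by rewrite ez; move=> H /(_ _) H2; have := H2 (ltac:(lia)); lia.
Qed.

End Rank.

Section Chains.

Variable n : nat.
Local Notation T := 'I_n.+1.
Local Notation Om := (Omega n.+1).
Implicit Types (x y z : osp n.+1) (a b : T) (A : {set T}).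

(** This is the corank ([crk_key]); the adjoined minimum gets the rank of the whole poset. *)
Definition key (x : Om) : nat := if x is Some y then #|starts y| else n.+1.

Lemma starts_le_card x : #|starts x| <= n.
Proof. by rewrite -[n in _ <= n]card_positions subset_leq_card ?starts_sub. Qed.

Lemma leSE x y : ((Some x : Om) <= (Some y : Om))%O = osp_le x y.
Proof. by []. Qed.

Lemma card_starts_lt x y : osp_le x y -> x != y -> #|starts y| < #|starts x|.
Proof.
move=> le ne; rewrite proper_card // properEneq le_starts // andbT.
by apply: contra ne => /eqP e; apply/eqP/(le_start_inj (osp_le_refl x) le).
Qed.

Lemma key_lt : {homo key : x y / (x < y)%O >-> y < x}.
Proof.
move=> [x|] [y|] //=; rewrite lt_neqAle => /andP[ne le] /=.
  by apply: card_starts_lt => //; apply: contraNneq ne => ->.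
by rewrite ltnS starts_le_card.
Qed.

Lemma rk_Omega (x : Om) : rk x = n.+1 - key x.
Proof.
apply: rk_key => [|{}x|{}x]; first exact: key_lt.
  by case: x => //= x; apply: leqW; apply: starts_le_card.
case: x => [x|] /=; last by rewrite ltnn.
rewrite ltnS leq_eqVlt => /orP[/eqP e|lt]; first by exists None; rewrite //= e.
(* To step down from [x], refine it to singletons [y], then coarsen [y] to the starts of [x] and one
   more position. *)
have [y [le_yx _ sy]] := fine_below x.
have [p pD] : exists p, p \in positions n :\: starts x.
  by apply/card_gt0P; rewrite cardsDS ?starts_sub // card_positions subn_gt0.
have /setDP[pP px] := pD.
have sS : p |: starts x \subset starts y by rewrite sy subUset sub1set pP starts_sub.
have [z le_yz ez] := coarsen_ex sS.
exists (Some z); last by rewrite /= ez cardsU1 px.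
rewrite lt_neqAle; apply/andP; split; last first.
  by apply: (le_starts_le le_yz le_yx); rewrite ez subsetUr.
by apply: contra px => /eqP[<-]; rewrite ez setU11.
Qed.

Lemma crk_key (x : Om) : crk x = key x.
Proof.
rewrite /crk rk_Omega subKn //; case: x => //= x; apply: leqW; exact: starts_le_card.
Qed.

Lemma greatest_ex : exists x : osp n.+1, starts x = set0 /\ forall y : Om, (y <= Some x)%O.
Proof.
have [x ex] := starts_ex (sub0set (positions n)); exists x; split=> // -[y|] //.
rewrite leSE; apply/osp_leP => a b _; have := card_starts x; rewrite ex cards0.
by have := level_lt x a; have := level_lt x b; lia.
Qed.

Lemma mem_proper_Omega (S : {fset nat}) (x : Om) :
  (forall s, s \in S -> 0 < s <= n) ->
  (x \in proper_part (Omega_sel n.+1 S)) = (x != None) && (key x \in S).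
Proof.
move=> hS; have noneA : None \in Omega_sel n.+1 S by rewrite !inE eqxx orbT.
have [t [et tmax]] := greatest_ex.
have tA : Some t \in Omega_sel n.+1 S.
  by rewrite !inE; apply/orP; right; apply/forallP.
rewrite inE; case: x => [x|] /=; last first.
  by rewrite [X in _ && (~~ X && _)](_ : _ = true) ?andbF //; apply/forall_inP.
rewrite [X in _ && (~~ X && _)](_ : _ = false) /=; last first.
  by apply/forall_inP=> /(_ _ noneA).
have greatP : [forall y in Omega_sel n.+1 S, (y <= Some x)%O] = [forall y : Om, (y <= Some x)%O].
  apply/forall_inP/forallP => [H y | H y _] //.
  by apply: le_trans (H _ tA); apply: tmax.
rewrite greatP !inE crk_key /= orbF; case: (boolP [forall y, _]) => /= [/forallP H | _]; last first.
  by rewrite orbF andbT.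
rewrite andbF; apply/esym/negP => /hS.
have : osp_le t x := H (Some t).
by move/card_starts_lt; have := tmax (Some x); rewrite et cards0; case: eqP => [<-|_ _ /(_ isT)] //; rewrite et cards0.
Qed.

End Chains.

(** * Coordinates of simplicial chains *)

Section Coordinates.

Variables (disp : Order.disp_t) (P : finPOrderType disp).
Implicit Types (c d : {set P}) (v : 'rV[rat]_#|{set P}|) (A : {set P}).

Definition coord v c : rat := v 0%R (enum_rank c).

Lemma coord_inj v w : coord v =1 coord w -> v = w.
Proof. by move=> e; apply/rowP=> i; rewrite -(enum_valK i); apply: e. Qed.

Lemma coord0 c : coord 0%R c = 0%R.
Proof. by rewrite /coord mxE. Qed.

Lemma coordZ a v c : coord (a *: v)%R c = (a * coord v c)%R.
Proof. by rewrite /coord mxE. Qed.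

Lemma coord_big (J : finType) (F : J -> 'rV[rat]_#|{set P}|) c :
  coord (\sum_j F j)%R c = (\sum_j coord (F j) c)%R.
Proof. by rewrite /coord summxE. Qed.

Lemma coord_set_vec c d : coord (set_vec c) d = (c == d)%:R%R.
Proof. by rewrite /coord mxE eqxx /= (inj_eq enum_rank_inj) eq_sym. Qed.

Lemma coord_sum (v : 'rV[rat]_#|{set P}|) : v = (\sum_c coord v c *: set_vec c)%R.
Proof.
rewrite [LHS]row_sum_delta (reindex enum_rank) //=.
exact/onW_bij/enum_rank_bij.
Qed.

Lemma coord_mul v (B : 'M[rat]_#|{set P}|) d :
  coord (v *m B)%R d = (\sum_c coord v c * coord (set_vec c *m B)%R d)%R.
Proof.
rewrite {1}(coord_sum v) mulmx_suml coord_big; apply: eq_bigr => c _.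
by rewrite -scalemxAl coordZ.
Qed.

Lemma sub_faces_mx v A k :
  (v <= faces_mx A k)%MS <-> (forall c, c \notin faces A k -> coord v c = 0%R).
Proof.
split=> [/submxP[w ->] c cF | H].
  by rewrite /coord /faces_mx mul_mx_diag !mxE enum_rankK (negPf cF) mulr0.
suff -> : v = (v *m faces_mx A k)%R by apply: submxMl.
apply: coord_inj => c; rewrite {2}/coord /faces_mx mul_mx_diag !mxE enum_rankK.
by case: (boolP (c \in _)) => [_ | /H e]; rewrite ?mulr1 // mulr0 e.
Qed.

Lemma coord_boundary v d :
  coord (v *m boundary_mx P)%R d = (\sum_c coord v c * coord (boundary c) d)%R.
Proof. by rewrite coord_mul; apply: eq_bigr => c _; rewrite set_vec_boundary. Qed.

Lemma coord_act (gT : finGroupType) (to : {action gT &-> P}) v g c :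
  coord (v *m set_act_mx to g)%R [set to x g | x in c] = coord v c.
Proof.
rewrite coord_mul (bigD1 c) //= set_vec_act coord_set_vec eqxx mulr1 big1 ?addr0 // => d ne.
rewrite set_vec_act coord_set_vec (inj_eq (imset_inj (act_inj to g))) (negPf ne).
exact: mulr0.
Qed.

End Coordinates.

(** * From chains of partitions to flags *)

Section FlagData.

Variable n : nat.
Local Notation T := 'I_n.+1.
Local Notation Om := (Omega n.+1).
Local Notation hd := (head set0).
Implicit Types (x y z : osp n.+1) (a b : T) (A : {set T}) (c : {set Om}) (S ks : seq nat).

Definition chain_of S c : bool :=
  [&& is_chain c, None \notin c, [forall x in c, key x \in S]
    & all (fun s => [exists x in c, key x == s]) S].

Lemma chain_ofP S c : chain_of S c ->
  [/\ {in c &, forall x y : Om, (x >=< y)%O}, None \notin c, forall x, Some x \in c -> #|starts x| \in S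
    & forall s, s \in S -> exists2 x, Some x \in c & #|starts x| = s].
Proof.
case/and4P=> /is_chainP ch cN /forall_inP kS /allP Sk; split=> // [x /kS|s /Sk] //.
case/exists_inP=> -[x|] xc /eqP e; first by exists x.
by rewrite xc in cN.
Qed.

Lemma chain_of_intro S c : {in c &, forall x y : Om, (x >=< y)%O} -> None \notin c ->
  (forall x, Some x \in c -> #|starts x| \in S) ->
  (forall s, s \in S -> exists2 x, Some x \in c & #|starts x| = s) -> chain_of S c.
Proof.
move=> ch cN kS Sk; apply/and4P; split=> //; first exact/is_chainP.
  by apply/forall_inP=> -[x /kS //|]; rewrite (negPf cN).
apply/allP=> s /Sk[x xc e]; apply/exists_inP; exists (Some x) => //.
exact/eqP.
Qed.

Lemma chain_le S c x y : chain_of S c -> Some x \in c -> Some y \in c ->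
  #|starts y| <= #|starts x| -> osp_le x y.
Proof.
case/chain_ofP=> ch _ _ _ xc yc le; have [-> | ne] := eqVneq x y; first exact: osp_le_refl.
case/orP: (ch _ _ xc yc); rewrite leSE // => /card_starts_lt.
by rewrite eq_sym => /(_ ne); rewrite ltnNge le.
Qed.

Lemma chain_inj S c x y : chain_of S c -> Some x \in c -> Some y \in c ->
  #|starts x| = #|starts y| -> x = y.
Proof.
move=> ch xc yc e; apply: osp_le_anti.
by rewrite !(chain_le ch) // e.
Qed.

Lemma key_inj S c : chain_of S c -> {in c &, injective (@key n)}.
Proof.
move=> ch; have [_ cN _ _] := chain_ofP ch.
move=> [x|] [y|] xc yc //= e; rewrite ?xc ?yc // in cN *.
by rewrite (chain_inj ch xc yc e).
Qed.

Lemma card_chain_of S c : uniq S -> chain_of S c -> #|c| = size S.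
Proof.
move=> S_uniq ch; have [_ cN kS Sk] := chain_ofP ch.
rewrite cardE -(size_map (@key n)); apply/perm_size/uniq_perm => //.
  by rewrite map_inj_in_uniq ?enum_uniq // => x y; rewrite !mem_enum; apply: key_inj ch _ _.
move=> s; apply/mapP/idP => [[[x|]] | /Sk[x xc <-]]; rewrite ?mem_enum.
- by move/kS => + ->.
- by rewrite (negPf cN).
by exists (Some x); rewrite ?mem_enum.
Qed.

(** Coranks are distinct along a chain, so as many members as coranks leaves exactly one of each. *)
Lemma faces_chain_of (F : {fset nat}) ks c : uniq ks -> F =i ks ->
  (forall s, s \in F -> 0 < s <= n) ->
  (c \in faces (proper_part (Omega_sel n.+1 F)) (size ks)) = chain_of ks c.
Proof.
move=> ks_uniq eF hF; rewrite inE; apply/and3P/idP => [[ch /subsetP sub /eqP cc] | ch].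
  have keyF (x : Om) : x \in c -> (x != None) && (key x \in ks) by move/sub; rewrite mem_proper_Omega // eF.
  have cN : None \notin c by apply/negP => /keyF.
  have inj : {in c &, injective (@key n)}.
    move=> x y xc yc e; have := is_chainP _ ch x y xc yc.
    by rewrite /Order.comparable !le_eqVlt => /orP[] /orP[/eqP // | /key_lt]; rewrite e ltnn.
  have [|s /mapP[x xc ->]||_ eqi] := uniq_min_size (s1 := map (@key n) (enum c)) (s2 := ks).
  - by rewrite map_inj_in_uniq ?enum_uniq // => x y; rewrite !mem_enum; apply: inj.
  - by move: xc; rewrite mem_enum => /keyF/andP[].
  - by rewrite size_map -cardE cc.
  apply: chain_of_intro => // [|x /keyF /andP[] //|s]; first exact/is_chainP.
  rewrite -eqi => /mapP[[x|]]; rewrite mem_enum; first by exists x.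
  by rewrite (negPf cN).
split; first by case/and4P: ch.
  have [_ cN kS _] := chain_ofP ch.
  by apply/subsetP=> -[x xc|]; rewrite mem_proper_Omega ?eF ?(negPf cN) //= kS.
by rewrite (card_chain_of ks_uniq ch).
Qed.

Definition omit (s : nat) c := [set x in c | key x != s].

Lemma del_subseq (X : eqType) i (s : seq X) : subseq (del i s) s.
Proof.
rewrite -[X in subseq _ X](cat_take_drop i s) cat_subseq //.
by have := drop_subseq (drop i s) 1; rewrite drop_drop.
Qed.

Lemma mem_del (X : eqType) (x0 : X) i (s : seq X) (x : X) : uniq s -> i < size s ->
  (x \in del i s) = (x \in s) && (x != nth x0 s i).
Proof.
move=> s_uniq lti; move: (s_uniq); rewrite -{1 3}(cat_take_drop i s) (drop_nth x0) //.
rewrite cat_uniq /= => /and4P[_ /norP[nt _] nd _].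
rewrite !mem_cat inE; have [-> | _] := eqVneq x (nth x0 s i); last by rewrite andbT.
by rewrite andbF (negPf nt) (negPf nd).
Qed.

Lemma omit_chain_of ks c i : uniq ks -> i < size ks -> chain_of ks c ->
  chain_of (del i ks) (omit (nth 0 ks i) c).
Proof.
move=> ks_uniq lti /chain_ofP[ch cN kS Sk]; apply: chain_of_intro.
- by move=> x y /setIdP[xc _] /setIdP[yc _]; apply: ch.
- by rewrite inE negb_and cN.
- by move=> x; rewrite inE (mem_del 0) // => /andP[/kS -> ].
move=> s; rewrite (mem_del 0) // => /andP[/Sk[x xc <-] ne].
by exists x; rewrite // inE xc.
Qed.

Definition starts_at c s : {set T} := \bigcup_(x in c | key x == s) (oapp (@starts n) set0 x).

Lemma starts_atE S c x : chain_of S c -> Some x \in c -> starts_at c #|starts x| = starts x.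
Proof.
move=> ch xc; rewrite /starts_at (big_pred1 (Some x)) // => y /=.
apply/andP/eqP => [[yc /eqP e] | ->]; last by rewrite eqxx.
exact: key_inj ch _ _ yc xc e.
Qed.

Lemma sorted_chain_finest s S c : sorted gtn (s :: S) -> chain_of (s :: S) c ->
  exists x, [/\ Some x \in c, #|starts x| = s & forall y, Some y \in c -> osp_le x y].
Proof.
move=> so ch; have [_ _ kS Sk] := chain_ofP ch.
have [x xc ex] := Sk s (mem_head _ _); exists x; split=> // y yc.
apply: (chain_le ch xc yc); have := kS y yc; rewrite ex inE => /orP[/eqP -> // | yS].
have gtn_tr : transitive gtn by move=> u v w /= h1 h2; apply: ltn_trans h2 h1.
by have /allP/(_ _ yS)/ltnW := order_path_min gtn_tr so.
Qed.

(* G is S_n or the stabilizer of the last element, and qd the mark of a partition. *)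
Variables (M : marks T) (qd : osp n.+1 -> M) (q0 : M) (G : {group 'S_n.+1}).
Hypothesis qd_le : forall x y, osp_le x y -> qd y = mfl (starts y) (qd x).
Hypothesis qd_ok : forall x, mok (qd x) (starts x).
Hypothesis qd_act : forall x g, g \in G -> qd (osp_act x g) = qd x.
Hypothesis act_tr : forall x y, starts x = starts y -> qd x = qd y ->
  exists2 g, g \in G & osp_act x g = y.
Hypothesis qd_ex : forall A q, A \subset positions n -> mok q A ->
  exists2 x, starts x = A & qd x = q.
Hypothesis q0_only : forall q : M, mok q set0 -> q = q0.

(** The mark of the finest member, the least element of the chain; [q0], the only mark of the empty
    set, serves the empty chain. *)
Definition mark_of c : M :=
  if [pick x in c | [forall y in c, (x <= y)%O]] is Some (Some x) then qd x else q0.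

Definition flag_data S c : M * seq {set T} := (mark_of c, [seq starts_at c s | s <- S]).

Lemma mark_ofE c x : Some x \in c -> None \notin c -> (forall y, Some y \in c -> osp_le x y) ->
  mark_of c = qd x.
Proof.
move=> xc cN min_x; rewrite /mark_of; case: pickP => [[y|] /andP[yc /forall_inP min_y] | /(_ (Some x))].
- by congr qd; apply: osp_le_anti; rewrite min_x // andbT; apply: (min_y (Some x)).
- by rewrite yc in cN.
rewrite xc => /negP[]; apply/forall_inP => -[y /min_x //|].
by rewrite (negPf cN).
Qed.

Lemma chain_of_nil c : chain_of [::] c -> c = set0.
Proof. by move=> ch; apply/eqP; rewrite -cards_eq0 (card_chain_of _ ch). Qed.

Lemma mark_of0 : mark_of set0 = q0.
Proof. by rewrite /mark_of; case: pickP => // x; rewrite inE. Qed.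

Local Notation act_set c g := [set Omega_action n.+1 x g | x in (c : {set Om})].

Lemma act_chain_of S c g : chain_of S c -> chain_of S (act_set c g).
Proof.
move=> /chain_ofP[ch cN kS Sk]; apply: chain_of_intro.
- move=> _ _ /imsetP[x xc ->] /imsetP[y yc ->].
  by have := ch x y xc yc; rewrite /Order.comparable !Omega_le_act.
- by apply/imsetP=> -[[x|]] // xc; rewrite (negPf cN) in xc.
- by move=> x /imsetP[[y|]] // yc [->]; rewrite starts_act kS.
move=> s /Sk[x xc <-]; exists (osp_act x g); last by rewrite starts_act.
by apply/imsetP; exists (Some x).
Qed.

Lemma flag_data_act S c g : sorted gtn S -> chain_of S c -> g \in G ->
  flag_data S (act_set c g) = flag_data S c.
Proof.
move=> so ch gG; have ch' := act_chain_of g ch; have [_ cN kS Sk] := chain_ofP ch.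
have mem_act x : Some x \in c -> Some (osp_act x g) \in act_set c g.
  by move=> xc; apply/imsetP; exists (Some x).
congr pair; last first.
  apply/eq_in_map => s /Sk[x xc <-]; rewrite (starts_atE ch xc).
  by rewrite -(starts_act x g) (starts_atE ch') ?mem_act.
case: S so ch ch' {kS Sk} => [|s S] so ch ch'.
  by rewrite !(chain_of_nil ch, chain_of_nil ch').
have [x [xc ex min_x]] := sorted_chain_finest so ch.
rewrite (mark_ofE xc cN min_x) -(qd_act x gG); apply: mark_ofE; first exact: mem_act.
  by have [] := chain_ofP ch'.
by move=> y /imsetP[[z|]] // zc [->]; rewrite osp_le_act min_x.
Qed.

(** Some [g] moves one finest member to the other. All members lie above the finest one, where
    [starts] determines an element, so [g] moves them correctly too. *)
Lemma flag_data_orbit S c c' : sorted gtn S -> chain_of S c -> chain_of S c' ->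
  flag_data S c = flag_data S c' -> exists2 g, g \in G & act_set c g = c'.
Proof.
case: S => [|s S] so ch ch' [].
  by rewrite !(chain_of_nil ch, chain_of_nil ch'); exists 1%g; rewrite ?group1 ?imset0.
move: so ch ch'; set S' := s :: S => so ch ch'.
have [_ cN kS Sk] := chain_ofP ch; have [_ cN' kS' Sk'] := chain_ofP ch'.
have [x [xc ex min_x]] := sorted_chain_finest so ch.
have [x' [xc' ex' min_x']] := sorted_chain_finest so ch'.
rewrite (mark_ofE xc cN min_x) (mark_ofE xc' cN' min_x') => eq_q eq_s eq_S.
have at_eq u : u \in S' -> starts_at c u = starts_at c' u.
  by rewrite inE => /orP[/eqP -> // | uS]; by move/eq_in_map: eq_S; apply.
have eq_x : starts x = starts x'.
  rewrite -(starts_atE ch xc) -(starts_atE ch' xc') ex ex'; exact: eq_s.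
have [g gG gx] := act_tr eq_x eq_q; exists g => //.
have main y y' : Some y \in c -> Some y' \in c' -> #|starts y| = #|starts y'| -> osp_act y g = y'.
  move=> yc yc' e; apply: (@le_start_inj _ x'); [ | exact: min_x' | ].
    by rewrite -gx osp_le_act min_x.
  by rewrite starts_act -(starts_atE ch yc) -(starts_atE ch' yc') -e at_eq ?kS.
apply/setP=> -[y|]; last first.
  by rewrite (negPf cN'); apply/imsetP=> -[[z|]] // zc; rewrite (negPf cN) in zc.
apply/imsetP/idP => [[[z|] // zc [->]] | yc].
  by have [y' yc' e] := Sk' _ (kS _ zc); rewrite (main z y').
have [z zc e] := Sk _ (kS' _ yc); exists (Some z) => //=.
by rewrite (main z y).
Qed.

Lemma gtn_trans : transitive gtn.
Proof. by move=> u v w /= h1 h2; apply: ltn_trans h2 h1. Qed.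

Lemma gtn_sorted_uniq ks : sorted gtn ks -> uniq ks.
Proof. by apply: sorted_uniq gtn_trans _ _ => u; apply: ltnn. Qed.

(** If the finest member is omitted, the mark passes to the next one by [qd_le]; if nothing is left,
    [q0_only] decides. *)
Lemma flag_face ks c i : sorted gtn ks -> i < size ks -> chain_of ks c ->
  face i (flag_data ks c) = flag_data (del i ks) (omit (nth 0 ks i) c).
Proof.
move=> so lti ch; have ks_uniq := gtn_sorted_uniq so.
have ch' := omit_chain_of ks_uniq lti ch; have [_ cN kS Sk] := chain_ofP ch.
have [_ cN' kS' Sk'] := chain_ofP ch'.
have so' : sorted gtn (del i ks) by exact: (subseq_sorted gtn_trans (del_subseq i ks) so).
have eq_at s : s \in del i ks -> starts_at c s = starts_at (omit (nth 0 ks i) c) s.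
  move=> /Sk'[x xc <-]; rewrite (starts_atE ch' xc) (starts_atE ch) //.
  by case/setIdP: xc.
have eq_map : del i [seq starts_at c s | s <- ks] =
    [seq starts_at (omit (nth 0 ks i) c) s | s <- del i ks].
  by rewrite /del -map_take -map_drop -map_cat; apply/eq_in_map.
rewrite /face /flag_data /= eq_map; congr pair.
move: so' ch' eq_at; case: (del i ks) => [|s S] so' ch' eq_at /=.
  by rewrite (chain_of_nil ch') mark_of0; apply/q0_only/mfl_ok.
have [x [xc ex min_x]] := sorted_chain_finest so' ch'.
have xc0 : Some x \in c by case/setIdP: xc.
rewrite (mark_ofE xc cN' min_x) -ex (starts_atE ch' xc).
have [y [yc ey min_y]] : exists y, [/\ Some y \in c, True & forall z, Some z \in c -> osp_le y z].
  case: (ks) so ch => [|s1 S1] so ch; last by have [y []] := sorted_chain_finest so ch; exists y.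
  by rewrite (chain_of_nil ch) inE in xc0.
by rewrite (mark_ofE yc cN min_y) -qd_le // min_y.
Qed.

Lemma flag_data_flags ks c : sorted gtn ks -> chain_of ks c ->
  flag_data ks c \in flags ks M (positions n).
Proof.
move=> so ch; have [_ cN kS Sk] := chain_ofP ch.
rewrite mem_flags; apply/and3P; split=> /=.
- case: ks so ch {kS Sk} => [|s S] so ch /=.
    rewrite (chain_of_nil ch) mark_of0 -(q0_only (mfl_ok set0 q0)); exact: mfl_ok.
  have [x [xc <- min_x]] := sorted_chain_finest so ch.
  by rewrite (mark_ofE xc cN min_x) (starts_atE ch xc).
- rewrite -map_comp -[X in _ == X]map_id; apply/eqP/eq_in_map => s /Sk[x xc <-] /=.
  by rewrite (starts_atE ch xc).
have : sorted (relpre (starts_at c) (fun A B : {set T} => B \subset A)) ks.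
  apply: (@sub_in_sorted _ (mem ks) gtn) so => [s u|]; last exact/allP.
  move=> /Sk[x xc <-] /Sk[y yc <-] /= lt; rewrite (starts_atE ch xc) (starts_atE ch yc).
  by apply/le_starts/(chain_le ch xc yc)/ltnW.
case: ks so ch Sk {kS} => //= s S so ch Sk; rewrite path_map => ->; rewrite andbT.
by have [x xc <-] := Sk s (mem_head _ _); rewrite (starts_atE ch xc) starts_sub.
Qed.

Lemma path_subset_total A (l : seq {set T}) : path (fun A B : {set T} => B \subset A) A l ->
  {in A :: l &, forall B C : {set T}, (B \subset C) || (C \subset B)}.
Proof.
elim: l A => [|B l IH] A /= => [_ B C|/andP[sBA pl]].
  by rewrite !inE => /eqP -> /eqP ->; rewrite subxx.
have sub_tr : transitive (fun A B : {set T} => B \subset A).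
  by move=> u v w /= h1 h2; apply: subset_trans h2 h1.
have /(order_path_min sub_tr)/allP mA : path (fun A B : {set T} => B \subset A) A (B :: l).
  by rewrite /= sBA.
move=> C D; rewrite !(in_cons A) => /orP[/eqP -> | Cl] /orP[/eqP -> | Dl].
- by rewrite subxx.
- by rewrite mA ?orbT.
- by rewrite mA.
exact: IH pl _ _ Cl Dl.
Qed.

Lemma flag_data_ex ks (u : M * seq {set T}) : sorted gtn ks -> u \in flags ks M (positions n) ->
  exists2 c, chain_of ks c & flag_data ks c = u.
Proof.
move=> so; rewrite mem_flags; case: u => q [|A l] /= /and3P[okq /eqP <-].
  move=> _; exists set0; last by rewrite /flag_data /= mark_of0 (q0_only okq).
  by apply: chain_of_intro => [x y||x|s]; rewrite ?inE.
case/andP=> sA pl; have [x ex <-] := qd_ex sA okq.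
have tot := path_subset_total pl.
have subA B : B \in A :: l -> B \subset starts x.
  rewrite ex inE => /orP[/eqP -> // | Bl].
  have sub_tr : transitive (fun A B : {set T} => B \subset A).
    by move=> ? ? ? /= h1 h2; apply: subset_trans h2 h1.
  by have /allP := order_path_min sub_tr pl; apply.
pose c : {set Om} := [set Some y | y : osp n.+1 & osp_le x y && (starts y \in A :: l)].
have cP y : (Some y \in c) = osp_le x y && (starts y \in A :: l).
  by rewrite mem_imset ?inE // => ? ? [].
have xc : Some x \in c by rewrite cP osp_le_refl ex mem_head.
have ch : chain_of (#|A| :: map (fun B : {set T} => #|B|) l) c.
  apply: chain_of_intro => [y z||y|s].
  - case/imsetP=> y' + ->; rewrite inE => /andP[ly my].
    case/imsetP=> z' + ->; rewrite inE => /andP[lz mz].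
    case/orP: (tot _ _ my mz) => sub; rewrite /Order.comparable !leSE.
      by rewrite (le_starts_le lz ly sub) orbT.
    by rewrite (le_starts_le ly lz sub).
  - by apply/imsetP=> -[].
  - by rewrite cP => /andP[_ my]; apply: (map_f (fun B : {set T} => #|B|)) my.
  move=> ms; have /mapP[B Bl ->] : s \in map (fun B : {set T} => #|B|) (A :: l) by [].
  have [y ly ey] := coarsen_ex (subA B Bl).
  by exists y; rewrite ?cP ?ly ?ey.
have main : map (starts_at c) (map (fun B : {set T} => #|B|) (A :: l)) = A :: l.
  rewrite -map_comp -[RHS]map_id; apply/eq_in_map => B Bl.
  have [y ly ey] := coarsen_ex (subA B Bl).
  by rewrite /= -ey (starts_atE ch) // cP ly ey.
have [_ cN _ _] := chain_ofP ch; exists c => //; rewrite /flag_data; congr pair; last exact: main.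
by apply: mark_ofE => // y; rewrite cP => /andP[].
Qed.

Lemma perm_keys ks c : sorted gtn ks -> chain_of ks c -> perm_eq (map (@key n) (enum c)) ks.
Proof.
move=> so ch; have [_ cN kS Sk] := chain_ofP ch; apply: uniq_perm.
- by rewrite map_inj_in_uniq ?enum_uniq // => x y; rewrite !mem_enum; apply: key_inj ch _ _.
- exact: gtn_sorted_uniq.
move=> s; apply/mapP/idP => [[[x|]] | /Sk[x xc <-]]; rewrite ?mem_enum.
- by move/kS => + ->.
- by rewrite (negPf cN).
by exists (Some x); rewrite ?mem_enum.
Qed.

Lemma count_index ks s : sorted gtn ks -> s \in ks -> count (fun u => s < u) ks = index s ks.
Proof.
elim: ks => //= u ks IH so; have /allP min_u := order_path_min gtn_trans so.
rewrite inE; have [-> _ | ne /= sk] := eqVneq s u.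
  rewrite ltnn add0n; apply/eqP; rewrite -leqn0 leqNgt -has_count.
  by apply/hasP => -[w /min_u /= lt1 lt2]; have := ltn_trans lt1 lt2; rewrite ltnn.
have ltsu : s < u := min_u _ sk.
by rewrite ltsu IH ?(path_sorted so).
Qed.

(** The exponent of the sign counts the members below the omitted one. These have larger corank, so
    it is the index of a corank in the decreasing list [ks]. *)
Lemma boundary_chain ks c : sorted gtn ks -> chain_of ks c ->
  boundary c = (\sum_(i < size ks) (-1) ^+ i *: set_vec (omit (nth 0 ks i) c))%R.
Proof.
move=> so ch; have [ct cN kS Sk] := chain_ofP ch; have pk := perm_keys so ch.
have kc (x : Om) : x \in c -> key x \in ks by rewrite -(perm_mem pk) => xc; apply/map_f; rewrite mem_enum.
pose tm s := ((-1) ^+ (index s ks) *: set_vec (omit s c))%R.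
transitivity (\sum_(x in c) tm (key x))%R.
  apply: eq_bigr => x xc; rewrite /tm -(count_index so (kc x xc)) -(seq.permP pk) count_map.
  congr (_ ^+ _ *: set_vec _)%R; last first.
    apply/setP=> y; rewrite !inE andbC; case yc: (y \in c) => //=.
    by rewrite (inj_in_eq (key_inj ch)).
  rewrite -sum1_count big_enum_cond -sum1_card; apply: eq_bigl => y; rewrite inE.
  case yc: (y \in c) => //=; apply/idP/idP => [/key_lt // | lt].
  rewrite lt_neqAle; apply/andP; split; first by apply: contraTneq lt => ->; rewrite ltnn.
  have := ct x y xc yc; rewrite /Order.comparable => /orP[le_xy | //].
  have [-> // | ne] := eqVneq x y.
  have /key_lt lt' : (x < y)%O by rewrite lt_neqAle ne.
  by have := ltn_trans lt lt'; rewrite ltnn.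
rewrite -big_enum -(big_map (@key n) xpredT tm) (perm_big _ pk) (big_nth 0) big_mkord.
by apply: eq_bigr => i _; rewrite /tm index_uniq // gtn_sorted_uniq.
Qed.

Definition chains ks : {set {set Om}} := [set c | chain_of ks c].

(** Faces missing different coranks are different, so terms for different [i] cannot cancel and the
    signs drop out. *)
Lemma boundary_eq0 ks (v : 'rV[rat]_#|{set Om}|) : sorted gtn ks ->
  (forall c, ~~ chain_of ks c -> coord v c = 0%R) ->
  (v *m boundary_mx Om = 0)%R <->
  (forall i c0, (i < size ks)%N -> chain_of ks c0 ->
    \sum_(c in chains ks | omit (nth 0 ks i) c == omit (nth 0 ks i) c0) coord v c = 0)%R.
Proof.
move=> so supp; have ks_uniq := gtn_sorted_uniq so.
have bE d : coord (v *m boundary_mx Om)%R d =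
    (\sum_(i < size ks) (-1) ^+ i * \sum_(c in chains ks | omit (nth 0 ks i) c == d) coord v c)%R.
  rewrite coord_boundary (bigID [in chains ks]) /= [X in (_ + X)%R]big1 ?addr0; last first.
    by move=> c; rewrite inE => /supp ->; rewrite mul0r.
  under [RHS]eq_bigr => i _ do rewrite mulr_sumr big_mkcondr.
  rewrite [RHS]exchange_big; apply: eq_bigr => c; rewrite inE => ch /=.
  rewrite (boundary_chain so ch) coord_big mulr_sumr; apply: eq_bigr => i _.
  rewrite coordZ coord_set_vec; case: eqP => _; last by rewrite !mulr0.
  by rewrite mulr1 mulrC.
split=> [vb i c0 lti ch0 | H]; last first.
  apply: coord_inj => d; rewrite coord0 bE big1 // => i _.
  have [/exists_inP[c0 ch0 /eqP <-] | /exists_inP none] := boolP [exists (c0 | chain_of ks c0), omit (nth 0 ks i) c0 == d].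
    by rewrite H ?mulr0.
  rewrite big_pred0 ?mulr0 // => c; rewrite inE; apply/negP => /andP[ch /eqP e].
  by apply: none; exists c => //; apply/eqP.
have := bE (omit (nth 0 ks i) c0); rewrite vb coord0 (bigD1 (Ordinal lti)) //=.
rewrite [X in (_ + X)%R]big1 ?addr0 => [/esym/eqP|j ne].
  by rewrite mulf_eq0 signr_eq0 => /eqP.
rewrite big_pred0 ?mulr0 // => c; rewrite inE; apply/negP => /andP[ch /eqP e].
have [_ _ _ Sk] := chain_ofP (omit_chain_of ks_uniq (ltn_ord j) ch).
have [|x] := Sk (nth 0 ks i).
  by rewrite (mem_del 0) // mem_nth // nth_uniq // eq_sym.
by rewrite e inE => /andP[_ /eqP ne'] /ne'.
Qed.

Definition fixed_cycles (F : {fset nat}) ks : 'M[rat]_#|{set Om}| :=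
  (cycles (proper_part (Omega_sel n.+1 F)) (size ks) :&: rfix_mx (set_repr (Omega_action n.+1)) G)%MS.

(* Fixed chains are constant on the fibers of flag_data, but their sums over these
   fibers are what satisfies the cycle equations on flags. *)
Definition data_sum ks (v : 'rV[rat]_#|{set Om}|) (u : M * seq {set T}) : rat :=
  (\sum_(c in chains ks | flag_data ks c == u) coord v c)%R.

(** * Fixed cycles and flag cycles *)

Section FixedCycles.

Variables (F : {fset nat}) (ks : seq nat).
Hypotheses (ks_path : path gtn n.+1 ks) (eF : F =i ks) (hF : forall s, s \in F -> 0 < s <= n).

Let ks_sorted : sorted gtn ks := path_sorted ks_path.
Let ks_uniq : uniq ks := gtn_sorted_uniq ks_sorted.
Let X := flags ks M (positions n).
Let D := descent_flags ks M (positions n).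

Lemma fixed_cyclesP (v : 'rV[rat]_#|{set Om}|) : (v <= fixed_cycles F ks)%MS <->
  [/\ forall c, ~~ chain_of ks c -> coord v c = 0%R,
      forall g c, g \in G -> coord v (act_set c g) = coord v c &
      forall i c0, i < size ks -> chain_of ks c0 ->
       (\sum_(c in chains ks | omit (nth 0 ks i) c == omit (nth 0 ks i) c0) coord v c = 0)%R].
Proof.
rewrite !sub_capmx; split=> [/andP[/andP[/sub_faces_mx supp /sub_kermxP vb]] /rfix_mxP fix_v | [supp fix_v vb]].
  have supp' c : ~~ chain_of ks c -> coord v c = 0%R.
    by move=> nch; apply: supp; rewrite (faces_chain_of _ ks_uniq eF hF).
  split=> // [g c gG|]; last exact/(boundary_eq0 ks_sorted supp').
  by rewrite -{1}(fix_v g gG) coord_act.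
apply/andP; split; first apply/andP; first split.
- apply/sub_faces_mx => c; rewrite (faces_chain_of _ ks_uniq eF hF); exact: supp.
- exact/sub_kermxP/(boundary_eq0 ks_sorted supp).
apply/rfix_mxP => g gG; apply: coord_inj => c.
have -> : c = act_set (act_set c g^-1%g) g.
  by rewrite -imset_comp -[LHS]imset_id; apply: eq_imset => x; rewrite /= -[x in LHS](actKV (Omega_action n.+1) g).
by rewrite coord_act [RHS]fix_v.
Qed.

Lemma flag_data_chains c : c \in chains ks -> flag_data ks c \in X.
Proof. by rewrite inE => ch; apply: flag_data_flags. Qed.

Lemma sum_data (P : pred (M * seq {set T})) (v : 'rV[rat]_#|{set Om}|) :
  (\sum_(u <- X | P u) data_sum ks v u = \sum_(c in chains ks | P (flag_data ks c)) coord v c)%R.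
Proof.
rewrite -big_enum_cond -(@sum_fibers _ _ (enum (chains ks)) X) ?flags_uniq //; last first.
  by move=> c; rewrite mem_enum; apply: flag_data_chains.
by apply: eq_bigr => u _; rewrite /data_sum -big_enum_cond.
Qed.

Lemma face_chains i c u : i < size ks -> c \in chains ks ->
  (face i (flag_data ks c) == u) = (flag_data (del i ks) (omit (nth 0 ks i) c) == u).
Proof. by move=> lti; rewrite inE => ch; rewrite flag_face. Qed.

(** The chains whose data have a given face form a union of classes with the same member omitted,
    and [v] sums to zero on each class. *)
Lemma data_sum_cycle v : (v <= fixed_cycles F ks)%MS -> flag_cycle ks M (positions n) (data_sum ks v).
Proof.
case/fixed_cyclesP => _ _ vb i lti u0 u0X.
rewrite (sum_data (fun u => face i u == face i u0)).
rewrite (eq_bigl (fun c => (c \in chains ks) &&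
  (flag_data (del i ks) (omit (nth 0 ks i) c) == face i u0))) => [|c]; last first.
  by case cC: (c \in chains ks); rewrite //= face_chains.
rewrite -big_enum_cond.
apply: (@sum_fibers0 _ _ (enum (chains ks)) (omit (nth 0 ks i))
  (fun d => flag_data (del i ks) d == face i u0) (coord v)) => c0.
by rewrite mem_enum inE big_enum_cond => ch0; apply: vb.
Qed.

(** Each fiber of [flag_data] is one orbit, so the sum of [v] over it is the common value times the
    nonzero size of the fiber. *)
Lemma data_sum_inj v : (v <= fixed_cycles F ks)%MS ->
  (forall u, u \in D -> data_sum ks v u = 0%R) -> v = 0%R.
Proof.
move=> vW vD; have pk : path gtn #|positions n|.+1 ks by rewrite card_positions.
have [inj _] := descent_param M pk.
have vX := inj _ (data_sum_cycle vW) vD.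
case/fixed_cyclesP: vW => supp fix_v _; apply: coord_inj => c; rewrite coord0.
have [ch | /supp //] := boolP (chain_of ks c).
have cC : c \in chains ks by rewrite inE.
have := vX _ (flag_data_chains cC); rewrite /data_sum.
rewrite (eq_bigr (fun=> coord v c)) => [|c' /andP[]].
  rewrite sumr_const => /eqP; rewrite mulrn_eq0 => /orP[/eqP e|/eqP //].
  have : c \in [pred c' in chains ks | flag_data ks c' == flag_data ks c] by rewrite inE cC eqxx.
  by rewrite (card0_eq e).
rewrite inE => ch' /eqP/esym e.
by have [g gG <-] := flag_data_orbit ks_sorted ch ch' e; rewrite fix_v.
Qed.

Lemma act_set_chain c g : chain_of ks (act_set c g) = chain_of ks c.
Proof.
apply/idP/idP => [/(act_chain_of g^-1%g) | ]; last exact: act_chain_of.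
by rewrite -imset_comp (eq_imset (g := id)) ?imset_id // => x; rewrite /= -[RHS](actK (Omega_action n.+1) g).
Qed.

Lemma omit_act s c g : omit s (act_set c g) = act_set (omit s c) g.
Proof.
have keyE (x : Om) : key (Omega_action n.+1 x g) = key x by case: x => //= x; rewrite starts_act.
apply/setP=> x; rewrite inE; apply/andP/imsetP => [[/imsetP[y yc ->]] | [y + ->]].
  by rewrite keyE => ne; exists y; rewrite // inE yc.
by rewrite inE keyE => /andP[yc ne]; split=> //; apply/imsetP; exists y.
Qed.

(** A flag cycle with the values [f] on descent flags is spread evenly over the fibers of
    [flag_data]. *)
Lemma fixed_cycles_ex (f : M * seq {set T} -> rat) :
  exists2 v, (v <= fixed_cycles F ks)%MS & forall u, u \in D -> data_sum ks v u = f u.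
Proof.
have pk : path gtn #|positions n|.+1 ks by rewrite card_positions.
have [_ surj] := descent_param M pk.
have [g g_cyc gD] := surj f.
pose fib u := #|[pred c in chains ks | flag_data ks c == u]|.
pose v : 'rV[rat]_#|{set Om}| := (\row_i (if chain_of ks (enum_val i) then
   g (flag_data ks (enum_val i)) / (fib (flag_data ks (enum_val i)))%:R else 0))%R.
have vE c : coord v c = (if chain_of ks c then g (flag_data ks c) / (fib (flag_data ks c))%:R else 0)%R.
  by rewrite /coord mxE enum_rankK.
have v_act h c : h \in G -> coord v (act_set c h) = coord v c.
  move=> hG; rewrite !vE act_set_chain; case: ifP => // ch.
  by rewrite flag_data_act.
have vX u : u \in X -> data_sum ks v u = g u.
  move=> /(flag_data_ex ks_sorted)[c ch e].
  rewrite /data_sum (eq_bigr (fun=> g u / (fib u)%:R)%R) => [|c' /andP[]]; last first.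
    by rewrite inE vE => -> /eqP ->.
  transitivity ((g u / (fib u)%:R) *+ fib u)%R; first exact: sumr_const.
  rewrite -(mulr_natr _ (fib u)) divfK // pnatr_eq0 -lt0n; apply/card_gt0P; exists c.
  by rewrite !inE ch e eqxx.
exists v => [|u uD]; last by rewrite vX ?gD //; move: uD; rewrite mem_filter => /andP[].
apply/fixed_cyclesP; split=> // [c /negPf nch | i c0 lti ch0]; first by rewrite vE nch.
have cC0 : c0 \in chains ks by rewrite inE.
pose S d : rat := (\sum_(c in chains ks | omit (nth 0%N ks i) c == d) coord v c)%R.
pose d0 := omit (nth 0 ks i) c0; rewrite -/(S d0).
have so' : sorted gtn (del i ks) := subseq_sorted gtn_trans (del_subseq i ks) ks_sorted.
(* The faces of chains with the data of [d0] form one orbit, so their sums [S d] are equal; the flag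
   equation makes the total zero, hence [S d0] is zero. *)
have S_orbit d : d \in map (omit (nth 0 ks i)) (enum (chains ks)) ->
    flag_data (del i ks) d = flag_data (del i ks) d0 -> S d = S d0.
  case/mapP=> c1; rewrite mem_enum inE => ch1 -> e.
  have [h hG <-] := flag_data_orbit so' (omit_chain_of ks_uniq lti ch0)
    (omit_chain_of ks_uniq lti ch1) (esym e).
  rewrite /S (reindex_inj (imset_inj (act_inj (Omega_action n.+1) h))) /=.
  apply: eq_big => [c | c _]; last exact: v_act.
  by rewrite !inE act_set_chain omit_act (inj_eq (imset_inj (act_inj (Omega_action n.+1) h))).
have tot : (\sum_(d <- undup (map (omit (nth 0%N ks i)) (enum (chains ks))) |
      flag_data (del i ks) d == flag_data (del i ks) d0) S d = 0)%R.
  rewrite (eq_bigr (fun d => \sum_(c <- enum (chains ks) | omit (nth 0%N ks i) c == d) coord v c)%R) => [|d _]; last first.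
    by rewrite big_enum_cond.
  rewrite (@sum_fibers _ _ _ _ (omit (nth 0 ks i)) (fun d => flag_data (del i ks) d == _)) ?undup_uniq //.
    rewrite big_enum_cond; have := g_cyc i lti (flag_data ks c0) (flag_data_chains cC0).
    set rhs := (\sum_(x <- _ | _) _)%R => rhs0; transitivity rhs => //; rewrite /rhs.
    rewrite [RHS]big_seq_cond [RHS](eq_bigr (data_sum ks v)) => [|u /andP[/vX -> //]].
    rewrite -[RHS]big_seq_cond (sum_data (fun u => face i u == face i (flag_data ks c0))).
    apply: eq_bigl => c; case cC: (c \in chains ks) => //=.
    by rewrite face_chains // (flag_face ks_sorted lti ch0).
  by move=> c cC; rewrite mem_undup map_f.
have d0m : d0 \in map (omit (nth 0 ks i)) (enum (chains ks)) by rewrite map_f // mem_enum.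
move: tot; rewrite big_seq_cond (eq_bigr (fun=> S d0)) => [|d /andP[]]; last first.
  by rewrite mem_undup => dm /eqP; apply: S_orbit.
rewrite -big_seq_cond big_const_seq iter_addr_0 => /eqP.
rewrite mulrn_eq0 => /orP[|/eqP //]; rewrite -leqn0 leqNgt -has_count => /hasP[].
by exists d0; rewrite ?mem_undup ?eqxx.
Qed.

Theorem rank_fixed_cycles : \rank (fixed_cycles F ks) = size D.
Proof.
have D_uniq : uniq D by rewrite filter_uniq ?flags_uniq.
pose Phi : 'M[rat]_(#|{set Om}|, size D) := (\matrix_(i, j)
  ((enum_val i \in chains ks) && (flag_data ks (enum_val i) == tnth (in_tuple D) j))%:R)%R.
have PhiE (v : 'rV[rat]_#|{set Om}|) j : (v *m Phi)%R 0%R j = data_sum ks v (tnth (in_tuple D) j).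
  rewrite /data_sum mxE (reindex enum_rank) /=; last exact/onW_bij/enum_rank_bij.
  rewrite [RHS]big_mkcond; apply: eq_bigr => c _; rewrite mxE enum_rankK.
  by case: (_ && _); rewrite ?mulr1 ?mulr0.
have ker0 : (fixed_cycles F ks :&: kermx Phi)%MS = 0%R.
  apply/eqP/rowV0P => v; rewrite sub_capmx => /andP[vW /sub_kermxP vPhi].
  apply: (data_sum_inj vW) => u /(tnthP (in_tuple D))[j ->].
  by rewrite -PhiE vPhi mxE.
have := mxrank_mul_ker (fixed_cycles F ks) Phi; rewrite ker0 mxrank0 addn0 => <-.
apply/eqP; rewrite -[_ == _]/(row_full _) -sub1mx; apply/row_subP => j.
have [v vW vD] := fixed_cycles_ex (fun u => (tnth (in_tuple D) j == u)%:R)%R.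
have -> : row j 1%:M = (v *m Phi)%R; last exact: submxMr.
apply/rowP=> j'; rewrite PhiE vD ?mem_tnth // !mxE (inj_eq _) //.
exact/tuple_uniqP.
Qed.

End FixedCycles.

End FlagData.

(** * Homology *)

(** With [U] zero the section is [V] itself; the work is to carry fixed vectors back through
    [in_factmod]. *)
Lemma rank_rfix_section (F : fieldType) (gT : finGroupType) (G H : {group gT}) n
    (rG : mx_representation F G n) (U V : 'M_n) (mU : mxmodule rG U) (mV : mxmodule rG V)
    (sHG : H \subset G) :
  U = 0%R -> \rank (rfix_mx (section_repr mU mV) H) = \rank (V :&: rfix_mx rG H)%MS.
Proof.
move=> U0; rewrite (rfix_submod _ sHG) mxrank_in_submod ?capmxSl //.
suff -> : \rank (<<in_factmod U V>> :&: rfix_mx (factmod_repr mU) H)%MS =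
          \rank (in_factmod U (V :&: rfix_mx rG H)%MS).
  have := mxrank_in_factmod U (V :&: rfix_mx rG H)%MS.
  have -> : \rank (U + V :&: rfix_mx rG H) = \rank (V :&: rfix_mx rG H)%MS.
    by rewrite U0 adds0mx.
  by have U0r : \rank U = 0; rewrite ?U0r ?addn0 // U0 mxrank0.
apply/eqmx_rank/andP; split; last first.
  rewrite sub_capmx genmxE submxMr ?capmxSl //=.
  by apply: submx_trans (rfix_factmod mU sHG); rewrite submxMr ?capmxSr.
set W := (_ :&: _)%MS.
have /submxP[X defW] : (W <= in_factmod U V)%MS by rewrite (submx_trans (capmxSl _ _)) ?genmxE.
have {}defW : W = in_factmod U (X *m V)%R by rewrite defW /in_factmod /= mulmxA.
rewrite defW submxMr // sub_capmx submxMl /=; apply/rfix_mxP=> h hH.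
have hG := subsetP sHG _ hH.
have /rfix_mxP/(_ h hH) : (W <= rfix_mx (factmod_repr mU) H)%MS by apply: capmxSr.
rewrite defW -(in_factmodJ mU) // => /eqP; rewrite -subr_eq0 -raddfB /= in_factmod_eq0 => sU.
by apply/eqP; rewrite -subr_eq0 -submx0 (submx_trans sU) // {1}U0 sub0mx.
Qed.

Lemma faces_card n (F : {fset nat}) ks k (c : {set Omega n.+1}) : F =i ks ->
  (forall s, s \in F -> 0 < s <= n) ->
  c \in faces (proper_part (Omega_sel n.+1 F)) k -> k <= size ks.
Proof.
move=> eF hF; rewrite inE => /and3P[/is_chainP ch /subsetP sub /eqP <-].
rewrite cardE -(size_map (@key n)); apply: uniq_leq_size => [|s /mapP[x + ->]]; last first.
  by rewrite mem_enum => /sub; rewrite mem_proper_Omega // eF => /andP[].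
rewrite map_inj_in_uniq ?enum_uniq // => x y; rewrite !mem_enum => xc yc e.
have := ch x y xc yc; rewrite /Order.comparable !le_eqVlt.
by case/orP=> /orP[/eqP // | /key_lt]; rewrite e ltnn.
Qed.

(** No face has more members than there are coranks, so the top homology consists of all cycles. *)
Lemma boundaries_top n (F : {fset nat}) ks : F =i ks -> (forall s, s \in F -> 0 < s <= n) ->
  boundaries (proper_part (Omega_sel n.+1 F)) (size ks) = 0%R.
Proof.
move=> eF hF; rewrite /boundaries (_ : faces_mx _ _ = 0%R) ?mul0mx ?genmx0 //.
apply/row_matrixP => i; rewrite row_faces_mx row0; case: (boolP (_ \in faces _ _)) => [|_].
  by move/(faces_card eF hF); rewrite ltnn.
by rewrite scale0r.
Qed.

(** * Multiplicities as counts of descent flags *)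

Section Multiplicities.

Variables (n : nat) (F : {fset nat}) (ks : seq nat).
Hypotheses (ks_path : path gtn n.+1 ks) (eF : F =i ks) (hF : forall s, s \in F -> 0 < s <= n).

Lemma size_fset_ks : #|` F| = size ks.
Proof.
apply/perm_size/uniq_perm; rewrite ?fset_uniq //.
exact/gtn_sorted_uniq/(path_sorted ks_path).
Qed.

Lemma rank_rfix_homology (G : {group 'S_n.+1}) :
  \rank (rfix_mx (Omega_homology n.+1 F) G) = \rank (fixed_cycles G F ks).
Proof.
rewrite /Omega_homology /homology_repr rank_rfix_section ?subsetT //.
  by rewrite size_fset_ks.
by rewrite size_fset_ks (boundaries_top eF hF).
Qed.

(** For n + 1 elements the possible nonzero starts are 1, ..., n, hence [n] on the right. The mark
    is trivial, and the natural order of the positions is used. *)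
Lemma b_unmarked_count : (b n.+1 F)%:Z%R = unmarked_count n ks.
Proof.
have pk : path gtn #|positions n|.+1 ks by rewrite card_positions.
rewrite -[in RHS](card_positions n) -(size_descent_flags_unit (@ord_inj n.+1) pk).
congr Posz; rewrite /b /triv_mult rank_rfix_homology.
apply: (@rank_fixed_cycles _ (unit_marks (@ord_inj n.+1)) (fun=> tt) tt) => //.
- by move=> x y /act_ex[g <-]; exists g; rewrite ?inE.
- by move=> A [] sA _; have [x ex] := starts_ex sA; exists x.
by case.
Qed.

Lemma mem_fix_last g : (g \in fix_last n.+1) = (g ord_max == ord_max).
Proof.
apply/astabP/eqP => [H | e i].
  by have := H ord_max; rewrite inE /= eqxx; apply.
by rewrite inE eqSS => /eqP ei; have -> : i = ord_max by apply: val_inj.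
Qed.

(** The mark is the start of the last element; the stabilizer preserves it, and together with
    [starts] it separates the orbits. *)
Lemma b'_marked_count : (b' n.+1 F)%:Z%R = marked_count n ks.
Proof.
rewrite -(size_descent_flags_floor ks_path); congr Posz; rewrite /b' /triv_mult rfix_subg rank_rfix_homology.
apply: (@rank_fixed_cycles _ (floor_marks n) (fun x => start x ord_max) ord0) => //.
- by move=> x y /le_start.
- by move=> x; rewrite /= startsU0 imset_f.
- by move=> x g; rewrite mem_fix_last => /eqP e; rewrite -{1}e start_act.
- by move=> x y ex eq; have [g gm <-] := act_ex_fix ex eq; exists g; rewrite // mem_fix_last gm.
- by move=> A q sA qA; apply: starts_mark_ex.
by move=> q; rewrite /= !inE orbF => /eqP.
Qed.

End Multiplicities.

(** * Vanishing and positivity by cases on the two largest coranks *)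

Lemma desc_path (F : {fset nat}) N : (forall s, s \in F -> s < N) ->
  exists2 ks, path gtn N ks & F =i ks.
Proof.
move=> hF; exists (sort geq F) => [|s]; last by rewrite mem_sort.
rewrite path_min_sorted; last by apply/allP=> s; rewrite mem_sort => /hF.
rewrite gtn_sorted_uniq_geq sort_uniq fset_uniq sort_sorted //.
Qed.

Theorem mainTheorem14 (m : nat) (T : {fset nat}) (hm : (2 <= m)%N)
    (hT : forall t : nat, t \in T -> (1 <= t <= m - 1)%N) :
  (b' m T = 0%N <-> ([fset m - 2; m - 1]%N `<=` T)%fset)
  /\ (([fset m - 2; m - 1]%N `<=` T)%fset -> b' m T = 0%N)
  /\ ((m - 1)%N \in T -> (m - 2)%N \notin T ->
        [/\ (1 <= b' m T)%N, (b' m T)%:Z%R = gamma m T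
          & gamma m T = ((m - 1) * b (m - 1) (T `\ (m - 1))%fset)%N%:Z%R])
  /\ ((m - 1)%N \notin T ->
        (1 <= b' m T)%N
        /\ ((b' m T)%:Z = m%:Z * (b m T)%:Z - (m - 1)%N%:Z * (b (m - 1) T)%:Z)%R).
Proof.
case: m hm hT => [|[|n]] // _; rewrite subn1 subn2 /= => hT.
have fsub2 : ([fset n; n.+1] `<=` T)%fset = (n \in T) && (n.+1 \in T).
  by rewrite fsubUset !fsub1set.
have partA : ([fset n; n.+1] `<=` T)%fset -> b' n.+2 T = 0.
  rewrite fsub2 => /andP[nT n1T].
  have [|ks pk eks] := @desc_path (T `\ n `\ n.+1)%fset n.
    move=> s; rewrite !in_fsetD1 => /and3P[ne1 ne2 /hT]; lia.
  have pk2 : path gtn n.+2 [:: n.+1, n & ks] by rewrite /= !ltnSn.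
  have eT : T =i [:: n.+1, n & ks].
    move=> s; rewrite !inE -eks !in_fsetD1.
    by case: eqP => [-> // | _]; case: eqP => [-> // | _].
  (* For m = n + 2 the value is (n + 2) f(n + 1, T) - (n + 1) f(n, T). The first term vanishes
     because n + 1 is in T; the second is, up to sign, a multiple of a count for [n] with first
     entry [n], so it vanishes too. *)
  apply/eqP; rewrite -eqz_nat (b'_marked_count pk2 eT hT) marked_countE // unmarked_count_full unmarked_count_over unmarked_count_full.
  by rewrite oppr0 !mulr0 subr0.
have partB : n.+1 \in T -> n \notin T -> [/\ 1 <= b' n.+2 T, (b' n.+2 T)%:Z%R = gamma n.+2 T &
    gamma n.+2 T = (n.+1 * b n.+1 (T `\ n.+1)%fset)%:Z%R].
  move=> n1T nT; have [|ks pk eks] := @desc_path (T `\ n.+1)%fset n.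
    move=> s; rewrite in_fsetD1 => /andP[ne1 sT]; have := hT s sT.
    by have : s != n by [apply: contraNneq nT => <-]; lia.
  have pk1 : path gtn n.+1 ks := path_gtn_weak (leqnSn n) pk.
  have pk2 : path gtn n.+2 (n.+1 :: ks) by rewrite /= ltnSn.
  have eT : T =i n.+1 :: ks.
    by move=> s; rewrite inE -eks in_fsetD1; case: eqP => [-> // | _].
  have hT' s : s \in (T `\ n.+1)%fset -> 0 < s <= n.
    by rewrite in_fsetD1 => /andP[ne1 /hT]; lia.
  have ks0 : 0 \notin ks by rewrite -eks; apply/negP=> /hT'.
  (* The largest corank m - 1 is selected, so [b] vanishes and [gamma] equals [b']; only the second
     term of the formula survives, made positive by [unmarked_count_over]. *)
  have eb : (b n.+2 T)%:Z%R = 0%R by rewrite (b_unmarked_count pk2 eT hT) unmarked_count_full.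
  have eb1 := b_unmarked_count pk1 eks hT'.
  have eb' : (b' n.+2 T)%:Z%R = (n.+1 * b n.+1 (T `\ n.+1)%fset)%:Z%R.
    rewrite (b'_marked_count pk2 eT hT) marked_countE // unmarked_count_full unmarked_count_over PoszM eb1.
    by rewrite mulr0 mulrN opprK add0r.
  have pos := unmarked_count_gt0 pk ks0; rewrite -eb1 ltz_nat in pos.
  split; rewrite /gamma ?eb ?subr0 //.
  by rewrite -lez_nat eb' lez_nat muln_gt0.
have partC : n.+1 \notin T -> 1 <= b' n.+2 T /\
    ((b' n.+2 T)%:Z = n.+2%:Z * (b n.+2 T)%:Z - n.+1%:Z * (b n.+1 T)%:Z)%R.
  move=> n1T; have hT' s : s \in T -> 0 < s <= n.
    move=> sT; have := hT s sT.
    by have : s != n.+1 by [apply: contraNneq n1T => <-]; lia.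
  have [s /hT'|ks pk eks] := @desc_path T n.+1; first by lia.
  have pk2 : path gtn n.+2 ks := path_gtn_weak (leqnSn _) pk.
  have ks0 : 0 \notin ks by rewrite -eks; apply/negP=> /hT'.
  have eb := b_unmarked_count pk2 eks hT; have eb1 := b_unmarked_count pk eks hT'.
  have eb' := b'_marked_count pk2 eks hT; rewrite marked_countE // -eb -eb1 in eb'.
  (* By monotonicity, m f(m - 1, T) - (m - 1) f(m - 2, T) is at least f(m - 1, T), which is
     positive. *)
  split=> //; have := unmarked_count_mono pk; have := unmarked_count_gt0 pk ks0; rewrite -eb -eb1.
  by rewrite ltz_nat lez_nat => pos le; rewrite -lez_nat eb'; nia.
split; last by [].
split=> [b0|]; last exact: partA.
rewrite fsub2; have [n1T | /partC[]] := boolP (n.+1 \in T); last by rewrite b0.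
by have [nT | /(partB n1T)[]] := boolP (n \in T); rewrite ?b0.
Qed.
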